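(* Let $G_1,G_2$ be non-elementary (i.e. not virtually cyclic) groups, each supporting a path system (resp. weak path system) $(X_i,\mathcal{PS}_i)$ and containing a contracting (resp. weakly contracting) element. (a) For any isomorphism $\phi:G_1\to G_2$ there exists a contracting (resp. weakly contracting) $g\in G_1$ such that $\phi(g)$ is also contracting (resp. weakly contracting). (b) If $H$ is an amenable group and $\phi:G_1\to H$ is any homomorphism, then for any $h\in\phi(G_1)$ there exists a contracting (resp. weakly contracting) $g\in\phi^{-1}(h)$.
   Context: Path systems on spaces. A path system $\mathcal{PS}$ in a metric space $X$ is a collection of $(\mu,\mu)$-quasi-geodesics in $X$, for some fixed $\mu$, such that any subpath of a path in $\mathcal{PS}$ is in $\mathcal{PS}$ and all pairs of points of $X$ can be connected by a path in $\mathcal{PS}$. Elements of $\mathcal{PS}$ are called special paths. Contracting sets. A subset $A\subseteq X$ is $\mathcal{PS}$-contracting with constant $C$ if there is a map $\pi_A:X\to A$ such that (1) $d(\pi_A(x),x)\le C$ for each $x\in A$, and (2) for all $x,y\in X$, if $d(\pi_A(x),\pi_A(y))\ge C$ then every special path $\delta$ from $x$ to $y$ satisfies $d(\delta,\pi_A(x))\le C$ and $d(\delta,\pi_A(y))\le C$. Path systems on groups. A path system $(X,\mathcal{PS})$ on a group $G$ is a proper isometric action of $G$ on a metric space $X$ preserving a path system $\mathcal{PS}$ on $X$. An infinite order $g\in G$ is ($\mathcal{PS}$-)contracting if for some (hence any) $x_0\in X$ the orbit $n\mapsto g^nx_0$ is a quasi-geodesic and there is a $g$-invariant $\mathcal{PS}$-contracting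 set $A\ni x_0$ on which $g$ acts coboundedly. WPD. Given an isometric action of $G$ on $X$, $g\in G$ is WPD if the orbits of $\langle g\rangle$ are Morse quasi-geodesics (every quasi-geodesic with endpoints on the orbit stays within bounded distance of it, with bound depending only on the quasi-geodesic constants) and for every $R\ge0$ and $x\in X$ there is $N=N(R,x)$ such that $|\{h\in G: d(x,hx)\le R,\ d(hg^Nx,g^Nx)\le R\}|<\infty$. Weak path systems. A weak path system $(X,\mathcal{PS})$ on $G$ is any isometric action of $G$ on a metric space $X$ preserving a path system $\mathcal{PS}$ on $X$. An infinite order $g\in G$ is weakly ($\mathcal{PS}$-)contracting if it is WPD and some (hence any) orbit of $\langle g\rangle$ is contained in a $\mathcal{PS}$-contracting $g$-invariant set $A$ on which $g$ acts coboundedly. *)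

(* Defs.v *)
From HB Require Import structures.
From mathcomp Require Import all_boot all_order all_algebra.
From mathcomp Require Import all_classical all_reals all_analysis.

Set Implicit Arguments.
Unset Strict Implicit.
Unset Printing Implicit Defensive.

Import Order.TTheory GRing.Theory Num.Theory.

Local Open Scope classical_set_scope.
Local Open Scope ring_scope.

Section Groups.
Variable G : groupType.

Definition expgz (g : G) (n : int) : G :=
  match n with
  | Posz k => (g ^+ k)%g
  | Negz k => (g ^- k.+1)%g
  end.

Definition infinite_order (g : G) : Prop :=
  forall n : nat, (0 < n)%N -> (g ^+ n)%g <> 1%g.

(* Some cyclic subgroup has finitely many left cosets; finite groups are
   included, since z = 1 is allowed. *)
Definition virtually_cyclic : Prop :=
  exists z : G,
    finite_set (range (fun x : G => [set (x * expgz z n)%g | n in [set: int]])).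

(* Amenability as a discrete group. *)
Definition amenable (R : realType) : Prop :=
  exists m : set G -> R,
    [/\ forall A, 0 <= m A,
        m setT = 1,
        forall A B, A `&` B = set0 -> m (A `|` B) = m A + m B
      & forall h A, m [set (h * a)%g | a in A] = m A].

End Groups.

Section Metric.
Variables (R : realType) (X : metricType R).

Definition dist_to_set (S : set X) (p : X) : R := inf [set mdist y p | y in S].

Definition mbounded (S : set X) : Prop :=
  exists r : R, forall x y, S x -> S y -> mdist x y <= r.

(* A path is q restricted to [a, b]; no continuity is required. *)
Definition quasi_geodesic (K L a b : R) (q : R -> X) : Prop :=
  forall s t, s \in `[a, b] -> t \in `[a, b] ->
    `|s - t| / K - L <= mdist (q s) (q t) <= K * `|s - t| + L.

Definition path_image (a b : R) (q : R -> X) : set X :=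
  [set q t | t in `[a, b]].

(* PS a b q: the path q : [a, b] -> X is special. *)
Definition path_family := R -> R -> (R -> X) -> Prop.

(* The second clause makes PS a family of functions on [a, b], independent of
   the values of q outside the interval. *)
Definition path_system_with (mu : R) (PS : path_family) : Prop :=
  [/\ forall a b q, PS a b q -> a <= b /\ quasi_geodesic mu mu a b q,
      forall a b q q', {in `[a, b], q =1 q'} -> PS a b q -> PS a b q',
      forall a b c d q, PS a b q -> a <= c -> c <= d -> d <= b -> PS c d q
    & forall x y, exists a b q, [/\ PS a b q, q a = x & q b = y]].

Definition path_system (PS : path_family) : Prop :=
  exists2 mu : R, 1 <= mu & path_system_with mu PS.

Definition contracting_with (PS : path_family) (C : R) (A : set X) : Prop :=
  exists pi : X -> X,
    [/\ forall x, A (pi x),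
        forall x, A x -> mdist (pi x) x <= C
      & forall x y, C <= mdist (pi x) (pi y) ->
          forall a b q, PS a b q -> q a = x -> q b = y ->
            dist_to_set (path_image a b q) (pi x) <= C /\
            dist_to_set (path_image a b q) (pi y) <= C].

Definition contracting_set (PS : path_family) (A : set X) : Prop :=
  exists C : R, contracting_with PS C A.

End Metric.

Section Actions.
Variables (R : realType) (G : groupType) (X : metricType R).
Variable act : G -> X -> X.

Definition isometric_action : Prop :=
  [/\ forall x, act 1%g x = x,
      forall g h x, act (g * h)%g x = act g (act h x)
    & forall g x y, mdist (act g x) (act g y) = mdist x y].

(* Metric properness, X not being assumed to be a proper space. *)
Definition proper_action : Prop :=
  forall (x : X) (r : R), finite_set [set g : G | mdist x (act g x) <= r].

Definition preserves_paths (PS : path_family X) : Prop :=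
  forall g a b q, PS a b q -> PS a b (fun t => act g (q t)).

Definition weak_path_system_on (PS : path_family X) : Prop :=
  [/\ isometric_action, path_system PS & preserves_paths PS].

Definition path_system_on (PS : path_family X) : Prop :=
  weak_path_system_on PS /\ proper_action.

Definition cyclic_orbit (g : G) (x : X) : set X :=
  range (fun n : int => act (expgz g n) x).

Definition quasi_geodesic_orbit (g : G) (x : X) : Prop :=
  exists K L : R, [/\ 1 <= K, 0 <= L
    & forall m n : int,
        `|m%:~R - n%:~R| / K - L <= mdist (act (expgz g m) x) (act (expgz g n) x)
                             <= K * `|m%:~R - n%:~R| + L].

Definition morse (S : set X) : Prop :=
  forall K L : R, 1 <= K -> 0 <= L ->
    exists D : R, forall a b q, a <= b -> quasi_geodesic K L a b q ->
      S (q a) -> S (q b) ->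
      forall t, t \in `[a, b] -> dist_to_set S (q t) <= D.

Definition WPD (g : G) : Prop :=
  (forall x, quasi_geodesic_orbit g x /\ morse (cyclic_orbit g x)) /\
  (forall (r : R) (x : X), 0 <= r -> exists N : nat,
     finite_set [set h : G | mdist x (act h x) <= r /\
                  mdist (act (h * g ^+ N)%g x) (act (g ^+ N)%g x) <= r]).

Definition cobounded_on (g : G) (A : set X) : Prop :=
  exists B : set X, [/\ B `<=` A, mbounded B
    & forall x, A x -> exists n : int, exists2 y, B y & x = act (expgz g n) y].

Definition contracting (PS : path_family X) (g : G) : Prop :=
  infinite_order g /\
  exists x0 : X, quasi_geodesic_orbit g x0 /\
    exists A : set X, [/\ A x0, act g @` A = A, contracting_set PS A
                        & cobounded_on g A].

Definition weakly_contracting (PS : path_family X) (g : G) : Prop :=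
  [/\ infinite_order g, WPD g
    & exists x0 : X, exists A : set X,
        [/\ cyclic_orbit g x0 `<=` A, act g @` A = A, contracting_set PS A
          & cobounded_on g A]].

End Actions.

(* Main.v *)
Require Import Defs.
From HB Require Import structures.
From mathcomp Require Import all_boot all_order all_algebra.
From mathcomp Require Import all_classical all_reals all_analysis.
From mathcomp Require Import zify ring lra.

(* A contracting element g yields an axis O = <g> o with a coarse projection pi. Its
   commensurator E is a finite union of cosets of <g>, and h O has a uniformly
   bounded projection to O for every h outside E. Hence the Behrstock inequality
   holds for O and h O, and a word W = g^n1 f1 ... g^nk fk with each fi outside E,
   with pi (fi o) and pi (fi^-1 o) close to o and with large exponents moves along a
   chain of axes in which each one separates its neighbours; the number of axes
   that a point has passed is a coarsely Lipschitz coordinate, and reading off the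
   exponent of W from it is a contracting projection to the orbit of W.

   For an isomorphism, both actions become actions of one group and
   W = g1^n v^i g2^m v^j is such a word for both, where no nonzero power of v
   commensurates g1 or g2. For a homomorphism to an amenable group, the kernel
   contains some u outside E, since E has infinite index and an invariant mean
   cannot see a paradoxical decomposition of G / E; then g^n u g^-n k has the same
   image as k. *)

Set Implicit Arguments.
Unset Strict Implicit.
Unset Printing Implicit Defensive.

Import Order.TTheory GRing.Theory Num.Theory.

Local Open Scope classical_set_scope.
Local Open Scope ring_scope.

(** * Special paths and coarse projections *)

(** Both kinds of contracting element are used only through [is_axis]: a quasi-geodesic orbit, a
    coarse projection to it, and finiteness of the set of elements that move two given points of the
    orbit little. Properness and WPD each supply this finiteness. Conversely the words [W] are given
    an axis in the same sense, which is enough for either conclusion, so the two versions share one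
    argument. Special paths need not be continuous and [X] need not be geodesic. Paths are therefore
    sampled with steps of length at most [mu + mu], and positions along an axis or a chain are
    integers. The isomorphism case threatens to be circular: seen from one action, the letter
    between large powers of [g1] contains the large power of [g2], while the exponent required of
    [g1] depends on how far that letter projects, and symmetrically. Surrounding the foreign power
    by powers of [v] breaks the circle: the Behrstock inequality for [v^(i - i')] leaves at most one
    bad exponent in a fixed range, with a bound that ignores what stands between the powers. *)

Ltac triangle x y z :=
  move: (metric_triangle x y z) (metric_triangle x z y) (metric_triangle y x z)
        (metric_sym x y) (metric_sym x z) (metric_sym y z) => ? ? ? ? ? ?.

(** Stands in for the intermediate value theorem along special paths, which need not be
    continuous. *)
Lemma int_discrete_ivt (f : nat -> int) (N : int) (n : nat) (k : int) :
  (forall i, (i < n)%N -> `|f i.+1 - f i| <= N) -> 0 <= N ->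
  f 0%N <= k <= f n -> exists2 i, (i <= n)%N & `|f i - k| <= N.
Proof.
elim: n => [|n IH] step N0 /andP[lo hi].
  by exists 0%N => //; lia.
have [kfn|fnk] := leP k (f n).
  have [i ? ?] := IH (fun i h => step i (ltnW h)) N0 (introT andP (conj lo kfn)).
  by exists i => //; lia.
by exists n.+1 => //; have := step n (leqnn _); lia.
Qed.

Section SpecialPaths.
Variables (R : realType) (X : metricType R) (PS : path_family X) (mu : R).
Hypotheses (mu1 : 1 <= mu) (PSmu : path_system_with mu PS).
Local Notation d := mdist.

Lemma special_exists x y : exists a b q, [/\ PS a b q, q a = x & q b = y].
Proof. by case: PSmu. Qed.

Lemma special_le a b q : PS a b q -> a <= b.
Proof. by case: PSmu => H _ _ _ /H[]. Qed.

Lemma special_sub a b q s t : PS a b q -> a <= s -> s <= t -> t <= b -> PS s t q.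
Proof. by case: PSmu => _ _ H _; exact: H. Qed.

Lemma special_qg a b q : PS a b q -> quasi_geodesic mu mu a b q.
Proof. by case: PSmu => H _ _ _ /H[]. Qed.

Lemma qg_upper (K L a b r s t : R) (q : R -> X) : 0 <= K ->
  quasi_geodesic K L a b q -> a <= s <= b -> a <= t <= b -> `|s - t| <= r ->
  d (q s) (q t) <= K * r + L.
Proof.
move=> K0 qg sab tab str.
have /andP[_ h] := qg s t (sab : s \in `[a, b]) (tab : t \in `[a, b]).
by apply: le_trans h _; rewrite lerD2r ler_wpM2l.
Qed.

Lemma special_upper a b q r s t : PS a b q -> a <= s <= b -> a <= t <= b ->
  `|s - t| <= r -> d (q s) (q t) <= mu * r + mu.
Proof. by move=> /special_qg; apply: qg_upper; exact: le_trans ler01 mu1. Qed.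

Lemma special_lower a b q r s t : PS a b q -> a <= s <= b -> a <= t <= b ->
  d (q s) (q t) <= r -> `|s - t| <= mu * (r + mu).
Proof.
move: mu1 => mu_ge1.
move=> /special_qg qg sab tab str.
have /andP[h _] := qg s t (sab : s \in `[a, b]) (tab : t \in `[a, b]).
have mu0 : 0 < mu by lra.
rewrite mulrC -ler_pdivrMr //; lra.
Qed.

Lemma special_diam r : exists2 D, 0 <= D & forall a b q, PS a b q ->
  d (q a) (q b) <= r -> forall s t, a <= s <= b -> a <= t <= b -> d (q s) (q t) <= D.
Proof.
move: mu1 => mu_ge1.
exists (Num.max 0 (mu * (mu * (r + mu)) + mu)) => [|a b q PSq dr s t sab tab].
  by rewrite le_max lexx.
have ab := special_le PSq.
have h : `|a - b| <= mu * (r + mu).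
  by apply: special_lower PSq _ _ dr; lra.
rewrite le_max; apply/orP; right.
apply: (special_upper PSq) => //; rewrite ler_norml; move: h; rewrite ler_norml; lra.
Qed.

(** The samples are the parameters [a + i] cut off at [b]; a unit step of the parameter moves the
    path by at most [mu * 1 + mu]. The bound on [n] turns estimates per step into estimates linear
    in the length of the path. *)
Lemma special_walk a b q : PS a b q -> exists n : nat, exists u : nat -> R,
  [/\ u 0%N = a, u n = b, forall i, a <= u i <= b,
      forall i, d (q (u i)) (q (u i.+1)) <= mu + mu
    & (forall t, a <= t <= b -> exists2 i, (i <= n)%N & d (q t) (q (u i)) <= mu + mu)
      /\ n%:R <= (b - a) + 1].
Proof.
move: mu1 => mu_ge1.
move=> PSq; have ab := special_le PSq.
exists (Num.truncn (b - a)).+1; exists (fun i => Num.min b (a + i%:R)).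
have ba : 0 <= b - a by lra.
have /andP[h1 h2] := truncn_itv ba.
split.
- by rewrite addr0 min_r.
- by rewrite min_l //; lra.
- move=> i; have i0 : 0 <= i%:R :> R by [].
  by case: (leP b (a + i%:R)) => ?; lra.
- move=> i; have i0 : 0 <= i%:R :> R by [].
  have -> : mu + mu = mu * 1 + mu by lra.
  apply: (special_upper PSq); rewrite -?natr1.
  + by case: (leP b (a + i%:R)) => ?; lra.
  + by case: (leP b (a + (i%:R + 1))) => ?; lra.
  by rewrite ler_norml; case: (leP b (a + i%:R)) => ?; case: (leP b (a + (i%:R + 1))) => ?; lra.
split; last by rewrite -natr1; lra.
move=> t tab; exists (Num.truncn (t - a)).
  by rewrite leqW // Num.Theory.le_truncn //; lra.
have ta : 0 <= t - a by lra.
have := truncn_itv ta; rewrite -natr1; set k : R := _%:R => kP.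
have k0 : 0 <= k by [].
have -> : mu + mu = mu * 1 + mu by lra.
apply: (special_upper PSq) => //.
- by case: (leP b (a + k)) => ?; lra.
- by rewrite ler_norml; case: (leP b (a + k)) => ?; lra.
Qed.

(* Unlike [contracting_with], the distance from the path is attained. *)
Definition projection (C : R) (S : set X) (pi : X -> X) : Prop :=
  [/\ 0 <= C, forall x, S (pi x), forall x, S x -> d (pi x) x <= C
    & forall a b q, PS a b q -> C <= d (pi (q a)) (pi (q b)) ->
        (exists2 t, a <= t <= b & d (q t) (pi (q a)) <= C) /\
        (exists2 t, a <= t <= b & d (q t) (pi (q b)) <= C)].

Section Projection.
Variables (C : R) (S : set X) (pi : X -> X).
Hypothesis piP : projection C S pi.

Let C0 : 0 <= C. Proof. by case: piP. Qed.
Let piS x : S (pi x). Proof. by case: piP. Qed.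
Let piid x : S x -> d (pi x) x <= C. Proof. by case: piP => _ _ + _; apply. Qed.
Let picontr a b q : PS a b q -> C <= d (pi (q a)) (pi (q b)) ->
  (exists2 t, a <= t <= b & d (q t) (pi (q a)) <= C) /\
  (exists2 t, a <= t <= b & d (q t) (pi (q b)) <= C).
Proof. by case: piP => _ _ _; apply. Qed.

(** Projections more than [C] apart are both close to a special path from [x] to [y], whose diameter
    is bounded in terms of [r]. *)
Lemma proj_bornologous r :
  exists2 c, 0 <= c & forall x y, d x y <= r -> d (pi x) (pi y) <= c.
Proof.
move: C0 => C_ge0.
have [D D0 HD] := special_diam r.
exists (D + 2 * C) => [|x y xy]; first by lra.
have [small|large] := leP (d (pi x) (pi y)) C; first by lra.
have [a [b [q [PSq qa qb]]]] := special_exists x y.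
move: xy large; rewrite -qa -qb => xy large.
have [[s s1 s2] [t t1 t2]] := picontr PSq (ltW large).
have := HD _ _ _ PSq xy _ _ s1 t1.
triangle (pi (q a)) (q s) (q t); triangle (pi (q a)) (q t) (pi (q b)); lra.
Qed.

Lemma proj_near_basepoint r :
  exists2 c, 0 <= c & forall x y, S y -> d x y <= r -> d x (pi x) <= c.
Proof.
move: C0 => C_ge0.
have [c c0 Hc] := proj_bornologous r; exists (Num.max 0 (r + C + c)).
  by rewrite le_max lexx.
move=> x y Sy xy; rewrite le_max; apply/orP; right.
have := Hc _ _ xy; have := piid Sy.
triangle x y (pi y); triangle x (pi y) (pi x); lra.
Qed.

(** If [q t] projects far from [pi (q a)], the piece of [q] before [t] already comes within [C] of
    [pi (q a) = q b]; the rest of the path is then short and contains [q t]. *)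
Lemma proj_along_path : exists2 D, 0 <= D & forall a b q, PS a b q ->
  q b = pi (q a) -> forall t, a <= t <= b ->
  d (pi (q a)) (pi (q t)) <= C \/ d (q t) (pi (q a)) <= D.
Proof.
move: C0 => C_ge0.
have [D D0 HD] := special_diam C.
exists D => // a b q PSq qb t tab.
have [?|large] := leP (d (pi (q a)) (pi (q t))) C; [by left|right].
have tab' := andP tab.
have PSt : PS a t q by apply: (special_sub PSq) => //; lra.
have [[s s1 s2] _] := picontr PSt (ltW large).
have PSs : PS s b q by apply: (special_sub PSq) => //; lra.
by rewrite -qb; apply: (HD _ _ _ PSs); rewrite ?qb //; lra.
Qed.

(** A special path from [x] to [y] is too short to reach the neighbourhood of [pi x], which
    contraction would force if the projections were more than [C] apart. *)
Lemma proj_far_contraction r : exists2 F, 0 <= F & forall x y,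
  d x y <= r -> F < d x (pi x) -> d (pi x) (pi y) <= C.
Proof.
move: C0 => C_ge0.
have [D D0 HD] := special_diam r.
exists (D + C) => [|x y xy far]; first by lra.
have [//|large] := leP (d (pi x) (pi y)) C.
have [a [b [q [PSq qa qb]]]] := special_exists x y.
have ab := special_le PSq.
move: xy large far; rewrite -qa -qb => xy large far.
have [[s s1 s2] _] := picontr PSq (ltW large).
have aab : a <= a <= b by lra.
have := HD _ _ _ PSq xy _ _ aab s1.
triangle (q a) (q s) (pi (q a)); lra.
Qed.

(** Only the threshold [F] depends on the step length [r]; the drift [C] per step does not, so long
    steps can be chosen once [C] is known. *)
Lemma proj_far_chain r : exists2 F, 0 <= F & forall (z : nat -> X) n,
  (forall i, d (z i) (z i.+1) <= r) ->
  (forall i, (i < n)%N -> F < d (z i) (pi (z i))) ->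
  d (pi (z 0%N)) (pi (z n)) <= n%:R * C.
Proof.
move: C0 => C_ge0.
have [F F0 HF] := proj_far_contraction r.
exists F => // z n step; elim: n => [|n IH] far.
  by rewrite mdistxx mul0r.
have := IH (fun i h => far i (ltnW h)).
have := HF _ _ (step n) (far n (leqnn _)).
by triangle (pi (z 0%N)) (pi (z n)) (pi (z n.+1)); rewrite -natr1 mulrDl; lra.
Qed.

Ltac purge := clear - R X PS mu mu1 PSmu C S pi piP C0 piS piid picontr.

(* An excursion of q outside a large neighbourhood of S is cut into steps of
   length s = K (C + 1); each step moves the projection by at most C, which is
   too slow for a (K, L)-quasi-geodesic unless the excursion is short. *)
Lemma proj_morse (K L r0 : R) : 1 <= K -> 0 <= L -> exists2 D, 0 <= D &
  forall a b q, quasi_geodesic K L a b q ->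
    d (q a) (pi (q a)) <= r0 -> d (q b) (pi (q b)) <= r0 ->
    forall t, a <= t <= b -> d (q t) (pi (q t)) <= D.
Proof.
move: C0 => C_ge0.
move=> K1 L0; set s := K * (C + 1).
have s1 : 1 <= s by rewrite /s; nra.
have [F F0 HF] := proj_far_chain (K * s + L).
(* [M] will bound the number [m + n] of steps of the excursion, by solving [(m + n - 2) * (C + 1) -
   L <= 2 * r + (m + n) * C]. *)
set r := Num.max r0 F; set M := 2 * r + L + 2 * C + 2.
have rr0 : r0 <= r by rewrite /r le_max lexx.
have rF : F <= r by rewrite /r le_max lexx orbT.
have M0 : 0 <= M by rewrite /M; lra.
have Ms0 : 0 <= M * s by rewrite mulr_ge0 //; lra.
have KMs0 : 0 <= K * (M * s) by rewrite mulr_ge0 //; lra.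
have MC0 : 0 <= M * C by rewrite mulr_ge0 //; lra.
exists (K * (M * s) + L + r + M * C) => [|a b q qg fa fb t tab]; first by lra.
pose f u := d (q u) (pi (q u)).
have [small|large] := leP (f t) r; first by rewrite /f in small; lra.
pose u (i : nat) := Num.min b (t + i%:R * s); pose v (i : nat) := Num.max a (t - i%:R * s).
have is0 i : 0 <= i%:R * s by rewrite mulr_ge0 //; lra.
have uab i : a <= u i <= b.
  by rewrite /u; move: (is0 i) tab; purge => *; case: (leP b (t + i%:R * s)) => ?; lra.
have vab i : a <= v i <= b.
  by rewrite /v; move: (is0 i) tab; purge => *; case: (leP a (t - i%:R * s)) => ?; lra.
have iS i : i.+1%:R * s = i%:R * s + s by rewrite -natr1 mulrDl mul1r.
have bigN (x : R) : exists n : nat, x <= n%:R * s.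
  exists (Num.truncn `|x|).+1.
  have /andP[_ /ltW h] := truncn_itv (normr_ge0 x).
  apply: le_trans (ler_norm x) _; apply: le_trans h _.
  by rewrite ler_peMr.
have exu : exists n, f (u n) <= r.
  have [n hn] := bigN (b - t); exists n.
  by rewrite /u min_l; [exact: le_trans fb _|lra].
have exv : exists n, f (v n) <= r.
  have [n hn] := bigN (t - a); exists n.
  by rewrite /v max_l; [exact: le_trans fa _|lra].
have [n fn nmin] := ex_minnP exu; have [m fm mmin] := ex_minnP exv.
have u0 : u 0%N = t by rewrite /u mul0r addr0 min_r //; lra.
have v0 : v 0%N = t by rewrite /v mul0r subr0 max_r //; lra.
(* Only the last step can be shortened by the cut at [b], whence the loss of a single [s]; the same
   happens at [a]. *)
have un : t + n%:R * s - s <= u n.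
  case: n fn nmin => [|n] fn nmin; first by rewrite u0 mul0r; lra.
  have : r < f (u n) by rewrite ltNge; apply/negP => /nmin; rewrite ltnn.
  have ne : t + n%:R * s <= b.
    rewrite leNgt; apply/negP => h.
    have := nmin n; rewrite ltnn; rewrite {1}/u min_l ?(ltW h) // => /(_ _)/negP.
    by apply=> //; exact: le_trans fb _.
  by rewrite iS /u iS; move: ne s1; purge => *; case: (leP b (t + (n%:R * s + s))) => ?; lra.
have vm : v m <= t - m%:R * s + s.
  case: m fm mmin => [|m] fm mmin; first by rewrite v0 mul0r; lra.
  have ne : a <= t - m%:R * s.
    rewrite leNgt; apply/negP => h.
    have := mmin m; rewrite ltnn; rewrite {1}/v max_l ?(ltW h) // => /(_ _)/negP.
    by apply=> //; exact: le_trans fa _.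
  by rewrite iS /v iS; move: ne s1; purge => *; case: (leP a (t - (m%:R * s + s))) => ?; lra.
have K0 : 0 <= K by lra.
have stepu i : d (q (u i)) (q (u i.+1)) <= K * s + L.
  apply: (qg_upper K0 qg) => //; rewrite /u iS ler_norml; move: (is0 i) tab s1; purge => *.
  by case: (leP b (t + i%:R * s)) => ?; case: (leP b (t + (i%:R * s + s))) => ?; lra.
have stepv i : d (q (v i)) (q (v i.+1)) <= K * s + L.
  apply: (qg_upper K0 qg) => //; rewrite /v iS ler_norml; move: (is0 i) tab s1; purge => *.
  by case: (leP a (t - i%:R * s)) => ?; case: (leP a (t - (i%:R * s + s))) => ?; lra.
have pu : d (pi (q t)) (pi (q (u n))) <= n%:R * C.
  rewrite -{1}u0; apply: (HF (q \o u)) => // i hi /=.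
  by apply: le_lt_trans rF _; rewrite ltNge; apply/negP => /nmin; rewrite leqNgt hi.
have pv : d (pi (q t)) (pi (q (v m))) <= m%:R * C.
  rewrite -{1}v0; apply: (HF (q \o v)) => // i hi /=.
  by apply: le_lt_trans rF _; rewrite ltNge; apply/negP => /mmin; rewrite leqNgt hi.
have Kp : 0 < K by lra.
have low : (m%:R + n%:R - 2) * (C + 1) - L <= d (q (u n)) (q (v m)).
  have /andP[h _] := qg _ _ (uab n : _ \in `[a, b]) (vab m : _ \in `[a, b]).
  apply: le_trans h; rewrite lerD2r ler_pdivlMr //.
  rewrite -mulrA [_ * K]mulrC -/s; apply: le_trans (ler_norm _).
  by rewrite !mulrDl; lra.
have n0 : 0 <= n%:R :> R by []. have m0 : 0 <= m%:R :> R by [].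
have mn : m%:R + n%:R <= M.
  have dd : d (q (u n)) (q (v m)) <= (r + n%:R * C) + (m%:R * C + r).
    apply: le_trans (metric_triangle _ (pi (q t)) _) _; apply: lerD.
      apply: le_trans (metric_triangle _ (pi (q (u n))) _) _.
      by rewrite (metric_sym _ (pi (q t))) lerD.
    apply: le_trans (metric_triangle _ (pi (q (v m))) _) _.
    by rewrite (metric_sym _ (q (v m))) lerD.
  by move: (le_trans low dd); rewrite /M; purge; lra.
have nM : n%:R <= M by move: mn m0; purge; lra.
have tu : d (q t) (q (u n)) <= K * (M * s) + L.
  apply: (qg_upper K0 qg) => //.
  have h : n%:R * s <= M * s by rewrite ler_wpM2r // (le_trans ler01).
  rewrite /u ler_norml; move: (is0 n) tab h Ms0; purge => *.
  by case: (leP b (t + n%:R * s)) => ?; lra.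
have pM : n%:R * C <= M * C by rewrite ler_wpM2r.
apply: le_trans (metric_triangle _ (pi (q (u n))) _) _; apply: lerD.
  by apply: le_trans (metric_triangle _ (q (u n)) _) _; exact: lerD.
by rewrite metric_sym (le_trans pu).
Qed.

Lemma special_morse r0 : exists2 D, 0 <= D & forall a b q, PS a b q ->
  d (q a) (pi (q a)) <= r0 -> d (q b) (pi (q b)) <= r0 ->
  forall t, a <= t <= b -> d (q t) (pi (q t)) <= D.
Proof.
move: mu1 => mu_ge1.
have [|D D0 HD] := proj_morse r0 mu1 (L := mu); first by lra.
by exists D => // a b q /special_qg; exact: HD.
Qed.

End Projection.

(** Compare the two projections along a special path from [x] to [pi x]. The bound [c] is uniform in
    [pi'], so one constant serves all translates of a projection. *)
Lemma proj_unique C C' S pi : projection C S pi -> 0 <= C' ->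
  exists2 c, 0 <= c & forall pi', projection C' S pi' ->
    forall x, d (pi x) (pi' x) <= c.
Proof.
move=> P C0'; have [D D0 HD] := proj_along_path P.
have [c c0 Hc] := proj_bornologous P C'.
case: (P) => C0 S1 id1 _.
exists (2 * C' + 2 * C + c + D) => [|pi' [_ S2 id2 co2] x]; first by lra.
have [a [b [q [PSq qa qb]]]] := special_exists x (pi x).
rewrite -qa in qb *.
have [small|large] := leP (d (pi' (q a)) (pi' (q b))) C'.
  have := id2 _ (S1 (q a)); rewrite -qb.
  by triangle (q b) (pi' (q b)) (pi' (q a)); lra.
have [[s s1 s2] _] := co2 _ _ _ PSq (ltW large).
have [h|h] := HD _ _ _ PSq qb _ s1; last first.
  by triangle (pi (q a)) (q s) (pi' (q a)); lra.
have := Hc _ _ s2; have := id1 _ (S2 (q a)).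
triangle (pi (q a)) (pi (q s)) (pi (pi' (q a))).
by triangle (pi (q a)) (pi (pi' (q a))) (pi' (q a)); lra.
Qed.

End SpecialPaths.

(** * Integer powers in groups *)

Section IntegerPowers.
Variable G : groupType.
Implicit Types (g h : G) (m n : int).
Local Open Scope group_scope.

Lemma expgz0 g : expgz g 0 = 1. Proof. by []. Qed.

Lemma expgz1 g : expgz g 1 = g. Proof. by []. Qed.

Lemma expgz_nat g (n : nat) : expgz g n = g ^+ n. Proof. by []. Qed.

Lemma expgzN g n : expgz g (- n) = (expgz g n)^-1.
Proof. by case: n => [[|n]|n] //=; rewrite ?invg1 ?invgK. Qed.

Lemma expgzS g n : expgz g (n + 1)%R = expgz g n * g.
Proof.
case: n => [n|[|n]].
- by rewrite -PoszD addn1 /= expgSr.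
- by rewrite NegzE addNr /= mulVg.
have -> : (Negz n.+1 + 1 = Negz n)%R by lia.
by rewrite /= (expgS g n.+1) invgM mulgVK.
Qed.

Lemma expgzB1 g n : expgz g (n - 1)%R = expgz g n * g^-1.
Proof. by rewrite -{2}(subrK 1%R n) expgzS mulgK. Qed.

Lemma expgzD g m n : expgz g (m + n)%R = expgz g m * expgz g n.
Proof.
elim: n => [|n IH|n IH]; first by rewrite addr0 mulg1.
  by rewrite -addn1 PoszD addrA !expgzS IH mulgA.
have -> : (- n.+1%:Z = - n%:Z - 1)%R by lia.
by rewrite addrA !expgzB1 IH mulgA.
Qed.

Lemma expgzM g m n : expgz g (m * n)%R = expgz (expgz g m) n.
Proof.
elim: n => [|n IH|n IH]; first by rewrite mulr0.
  by rewrite -addn1 PoszD mulrDr mulr1 expgzS expgzD IH.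
have -> : (- n.+1%:Z = - n%:Z - 1)%R by lia.
by rewrite mulrBr mulr1 expgzB1 expgzD IH (expgzN g m).
Qed.

Lemma expgz_conj a g n : expgz (a * g * a^-1) n = a * expgz g n * a^-1.
Proof.
elim: n => [|n IH|n IH]; first by rewrite mulg1 mulgV.
  by rewrite -addn1 PoszD !expgzS IH !mulgA mulgVK.
have -> : (- n.+1%:Z = - n%:Z - 1)%R by lia.
by rewrite !expgzB1 IH !invgM invgK !mulgA mulgVK.
Qed.

Lemma expgz_intertwine h x y n : h * x = y * h -> h * expgz x n = expgz y n * h.
Proof.
move=> e; have -> : y = h * x * h^-1 by rewrite e mulgK.
by rewrite expgz_conj mulgVK.
Qed.

Lemma expgz_eq1 g n : infinite_order g -> expgz g n = 1 -> n = 0.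
Proof.
move=> g_inf; case: n => [[|n]|n] //= e; first by case: (g_inf n.+1).
by case: (g_inf n.+1) => //; rewrite -[LHS]invgK e invg1.
Qed.

End IntegerPowers.

Section Multiplicative.
Variables (G H : groupType) (phi : {multiplicative G -> H}).
Local Open Scope group_scope.

Lemma multiplicative1 : phi 1 = 1.
Proof. by apply: (@mulgI _ (phi 1)); rewrite -gmulfM !mulg1. Qed.

Lemma multiplicativeV g : phi g^-1 = (phi g)^-1.
Proof. by apply: (@mulgI _ (phi g)); rewrite -gmulfM !mulgV multiplicative1. Qed.

Lemma expgz_morph g n : phi (expgz g n) = expgz (phi g) n.
Proof.
elim: n => [|n IH|n IH]; first exact: multiplicative1.
  by rewrite -addn1 PoszD !expgzS gmulfM IH.
have -> : (- n.+1%:Z = - n%:Z - 1)%R by lia.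
by rewrite !expgzB1 gmulfM multiplicativeV IH.
Qed.

End Multiplicative.

Lemma finite_set_pigeonhole (T : choiceType) (F : set T) : finite_set F ->
  exists n, forall f : nat -> T, (forall i, (i <= n)%N -> F (f i)) ->
    exists i j, [/\ (i < j)%N, (j <= n)%N & f i = f j].
Proof.
move=> /finite_seqP[s sF]; exists (size s) => f Ff.
have : ~~ uniq [seq f i | i <- iota 0 (size s).+1].
  apply/negP => u; suff : (size [seq f i | i <- iota 0 (size s).+1] <= size s)%N.
    by rewrite size_map size_iota ltnn.
  apply: uniq_leq_size u _ => _ /mapP[i + ->].
  rewrite mem_iota add0n ltnS => /andP[_ /Ff]; by rewrite sF.
case/(uniqPn (f 0%N)) => i [j []]; rewrite size_map size_iota => ij j2 e.
exists i, j; split=> //; move: e; rewrite !(nth_map 0%N) ?size_iota ?(ltn_trans ij) //.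
by rewrite !nth_iota ?(ltn_trans ij).
Qed.

(** * Isometric actions and orbits *)

Section Action.
Variables (R : realType) (G : groupType) (X : metricType R) (act : G -> X -> X).
Variables (PS : path_family X) (mu : R).
Hypotheses (mu1 : 1 <= mu) (PSmu : path_system_with mu PS).
Hypotheses (isom : isometric_action act) (PSact : preserves_paths act PS).
Local Notation d := mdist.

Lemma act1 x : act 1%g x = x. Proof. by case: isom. Qed.

Lemma actM h k x : act (h * k)%g x = act h (act k x). Proof. by case: isom. Qed.

Lemma act_dist h x y : d (act h x) (act h y) = d x y. Proof. by case: isom. Qed.

Lemma actK h x : act h^-1%g (act h x) = x.
Proof. by rewrite -actM mulVg act1. Qed.

Lemma dist_actV h x y : d (act h x) y = d x (act h^-1%g y).
Proof. by rewrite -(act_dist h^-1%g) actK. Qed.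

Lemma projection_act C S pi h : projection PS C S pi ->
  projection PS C (act h @` S) (fun x => act h (pi (act h^-1%g x))).
Proof.
case=> C0 piS piid pico; split=> // [x|_ [x Sx <-]|a b q PSq].
- by exists (pi (act h^-1%g x)).
- by rewrite actK act_dist; exact: piid.
rewrite act_dist => far; have [[s s1 s2] [t t1 t2]] := pico _ _ _ (PSact h^-1%g PSq) far.
by split; [exists s|exists t]; rewrite // metric_sym dist_actV metric_sym.
Qed.

Section Orbit.
Variables (g : G) (o : X).
Local Notation pt n := (act (expgz g n) o).

Lemma act_orbit m n : act (expgz g m) (pt n) = pt (m + n).
Proof. by rewrite expgzD actM. Qed.

Lemma act_orbit0 : pt 0 = o. Proof. exact: act1. Qed.

Lemma orbit_act_image n : act (expgz g n) @` cyclic_orbit act g o = cyclic_orbit act g o.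
Proof.
apply/seteqP; split=> [_ [_ [m _ <-] <-]|_ [m _ <-]].
  by exists (n + m) => //; rewrite act_orbit.
by exists (pt (m - n)); [exists (m - n)|rewrite act_orbit addrC subrK].
Qed.

Hypothesis qi : quasi_geodesic_orbit act g o.

Lemma orbit_close (N : int) :
  exists2 r, 0 <= r & forall m n, `|m - n| <= N -> d (pt m) (pt n) <= r.
Proof.
have [K [L [K1 L0 KL]]] := qi.
exists (K * `|N|%:~R + L) => [|m n mn].
  by rewrite addr_ge0 // mulr_ge0 ?ler0z // (le_trans ler01).
have /andP[_ h] := KL m n; apply: le_trans h _; rewrite lerD2r.
apply: ler_wpM2l; first exact: le_trans ler01 K1.
by rewrite -intrB -intr_norm ler_int; apply: le_trans (ler_norm N).
Qed.

Lemma orbit_far (r : R) :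
  exists2 N : int, 0 <= N & forall m n, d (pt m) (pt n) <= r -> `|m - n| <= N.
Proof.
have [K [L [K1 L0 KL]]] := qi.
exists (Num.truncn `|K * (r + L)|).+1%:Z => // m n mn.
have /andP[h _] := KL m n.
have K0 : 0 < K by apply: lt_le_trans K1.
have : `|m%:~R - n%:~R| <= K * (r + L).
  rewrite mulrC -ler_pdivrMr //; lra.
rewrite -intrB -intr_norm => h2; rewrite -(ler_int R).
apply: le_trans h2 _; apply: le_trans (ler_norm _) _.
by have /andP[_ /ltW] := truncn_itv (normr_ge0 (K * (r + L))).
Qed.

End Orbit.
End Action.

Lemma orbit_lipschitz (R : realType) (G : groupType) (X : metricType R)
    (act : G -> X -> X) (isom : isometric_action act) g o m n :
  mdist (act (expgz g m) o) (act (expgz g n) o) <= `|m - n|%:~R * mdist o (act g o).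
Proof.
wlog mn : m n / m <= n => [W|].
  have [/W//|/ltW/W] := leP m n.
  by rewrite (metric_sym (act (expgz g m) o)) distrC.
have -> : n = m + `|m - n|%N by lia.
rewrite (_ : `|_| = `|m - n|%N%:Z); last by lia.
elim: `|m - n|%N => [|j IH]; first by rewrite addr0 mdistxx mul0r.
apply: le_trans (metric_triangle _ (act (expgz g (m + j)) o) _) _.
rewrite -addn1 PoszD intrD mulrDl mul1r; apply: lerD => //.
by rewrite addrA (expgzD g (m + j) 1) (actM isom (expgz g (m + j))) (act_dist isom).
Qed.

Definition axis_proj (R : realType) (G : groupType) (X : metricType R)
    (act : G -> X -> X) (g : G) (o : X) (iota : X -> int) (x : X) : X :=
  act (expgz g (iota x)) o.

(* iota x is the exponent of the projection of x to the orbit of o. *)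
Record is_axis (R : realType) (G : groupType) (X : metricType R) (act : G -> X -> X)
    (PS : path_family X) (g : G) (o : X) (C : R) (iota : X -> int) : Prop := IsAxis {
  axis_qi : quasi_geodesic_orbit act g o;
  axis_projection : projection PS C (cyclic_orbit act g o) (axis_proj act g o iota);
  axis_wpd : forall r, exists N : nat, finite_set [set h : G |
    mdist o (act h o) <= r /\
    mdist (act (h * g ^+ N)%g o) (act (g ^+ N)%g o) <= r]
}.

Definition between (i j k : int) : bool := (i <= k <= j) || (j <= k <= i).

Lemma between_min (i j k : int) : 0 <= k <= `|i - j| -> between i j (Num.min i j + k).
Proof. by rewrite /between; case: (leP i j) => ?; lia. Qed.

(** * Projections to the axis of a contracting element *)

Lemma finite_int_ball (M : int) : finite_set [set e : int | `|e| <= M].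
Proof.
apply: (sub_finite_set _ (finite_image (fun i : nat => i%:Z - M) (finite_II `|(M + M + 1)%R|%N))).
by move=> e /= eM; exists `|(e + M)%R|%N; rewrite /=; lia.
Qed.

Section Axis.
Variables (R : realType) (G : groupType) (X : metricType R) (act : G -> X -> X).
Variables (PS : path_family X) (mu : R).
Hypotheses (mu1 : 1 <= mu) (PSmu : path_system_with mu PS).
Hypotheses (isom : isometric_action act) (PSact : preserves_paths act PS).
Variables (g : G) (o : X) (C : R) (iota : X -> int).
Hypothesis A : is_axis act PS g o C iota.
Local Notation d := mdist.
Local Notation pt n := (act (expgz g n) o).
Local Notation pi := (axis_proj act g o iota).

Let qi := axis_qi A.
Let piP := axis_projection A.

Lemma axis_C_ge0 : 0 <= C. Proof. by case: piP. Qed.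

Lemma axis_proj_orbit x : cyclic_orbit act g o (pi x).
Proof. by case: piP => _ + _ _; apply. Qed.

Lemma axis_proj_id x : cyclic_orbit act g o x -> d (pi x) x <= C.
Proof. by case: piP => _ _ + _; apply. Qed.

Lemma orbit_pt n : cyclic_orbit act g o (pt n). Proof. by exists n. Qed.

Lemma axis_proj_pt n : d (pi (pt n)) (pt n) <= C.
Proof. exact: axis_proj_id (orbit_pt n). Qed.

Lemma axis_infinite_order : infinite_order g.
Proof.
move=> n n0 gn; have [N N0 HN] := orbit_far qi 0.
have := HN (n%:Z * (N + 1)) 0.
rewrite expgzM expgz_nat gn (_ : expgz 1%g (N + 1) = 1%g).
  by rewrite mdistxx => /(_ (lexx _)); rewrite subr0 normrM; move: n0 N0; clear; nia.
by rewrite -(expgz0 1%g) -expgzM mul0r.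
Qed.

Lemma axis_proj_lip r :
  exists2 c, 0 <= c & forall x y, d x y <= r -> d (pi x) (pi y) <= c.
Proof. exact: (proj_bornologous mu1 PSmu piP). Qed.

Lemma axis_coord_lip r :
  exists2 N, 0 <= N & forall x y, d x y <= r -> `|iota x - iota y| <= N.
Proof.
have [c c0 Hc] := axis_proj_lip r; have [N N0 HN] := orbit_far qi c.
by exists N => // x y /Hc/HN.
Qed.

(** Conjugating [pi] by [g^n] gives another projection to the same orbit with the same constant, to
    which [proj_unique] applies. *)
Lemma axis_proj_equivariant : exists2 c, 0 <= c &
  forall n x, d (pi (act (expgz g n) x)) (act (expgz g n) (pi x)) <= c.
Proof.
have [c c0 Hc] := proj_unique mu1 PSmu piP axis_C_ge0; exists c => // n x.
have P := projection_act isom PSact (expgz g n) piP.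
rewrite orbit_act_image // in P.
by have := Hc _ P (act (expgz g n) x); rewrite actK.
Qed.

Lemma axis_near r : exists2 c, 0 <= c & forall x n, d x (pt n) <= r -> d x (pi x) <= c.
Proof.
have [c c0 Hc] := proj_near_basepoint mu1 PSmu piP r.
by exists c => // x n; apply: Hc; exact: orbit_pt.
Qed.

Lemma special_morse_between r0 : exists2 D, 0 <= D & forall a b q, PS a b q ->
  forall s t, a <= s <= b -> a <= t <= b ->
  d (q s) (pi (q s)) <= r0 -> d (q t) (pi (q t)) <= r0 ->
  forall u, (s <= u <= t) || (t <= u <= s) -> d (q u) (pi (q u)) <= D.
Proof.
have [D D0 HD] := special_morse mu1 PSmu piP r0; exists D => // a b q PSq s t sab tab ns nt u.
by case/orP => ust; [apply: (HD s t q)|apply: (HD t s q)] => //;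
  apply: (special_sub PSmu PSq); lra.
Qed.

(** The path stays near the orbit by the Morse property, and its integer coordinate changes by at
    most [N] between samples, so it comes within [N] of each intermediate value. *)
Lemma axis_segment r0 : exists2 r, 0 <= r & forall a b q, PS a b q ->
  forall s t, a <= s <= b -> a <= t <= b ->
  d (q s) (pi (q s)) <= r0 -> d (q t) (pi (q t)) <= r0 ->
  forall k, between (iota (q s)) (iota (q t)) k ->
  exists2 u, (s <= u <= t) || (t <= u <= s) & d (q u) (pt k) <= r.
Proof.
have [D D0 HD] := special_morse mu1 PSmu piP r0.
have [N N0 HN] := axis_coord_lip (mu + mu).
have [r r_ge0 Hr] := orbit_close qi N.
exists (D + r) => [|a b q PSq s t sab tab ns nt k kst]; first by lra.
wlog st : s t sab tab ns nt kst / s <= t => [W|].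
  have [/W|/ltW ts] := leP s t; first exact.
  have [|u ust h] := W t s tab sab nt ns _ ts; first by rewrite /between orbC.
  by exists u; rewrite 1?orbC.
have PSs : PS s t q by apply: (special_sub PSmu PSq); lra.
have [n [u [u0 un uab ustep _]]] := special_walk mu1 PSmu PSs.
have [i [ik]] : exists i, `|iota (q (u i)) - k| <= N.
  pose f (i : nat) := iota (q (u i)).
  have fstep i : `|f i.+1 - f i| <= N by rewrite distrC; exact: HN.
  rewrite -u0 -un in kst; case/orP: kst => kst.
    have [i _ ?] := int_discrete_ivt (fun i _ => fstep i) N0 (kst : f 0%N <= k <= f n).
    by exists i.
  have nstep i : `|- f i.+1 - - f i| <= N by rewrite -opprD normrN.
  have kst' : - f 0%N <= - k <= - f n by rewrite !lerN2 andbC.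
  have [i _ h] := int_discrete_ivt (fun i _ => nstep i) N0 kst'.
  by exists i; move: h; rewrite -opprD normrN.
have near : d (q (u i)) (pi (q (u i))) <= D by exact: HD PSs ns nt _ (uab i).
exists (u i); first by rewrite uab.
have := Hr _ _ ik => rk.
by apply: le_trans (metric_triangle _ (pi (q (u i))) _) _; apply: lerD.
Qed.

(** Two elements of the set differ by one that moves both [o] and [g^N o] by at most [r + r]; hence
    a single [N] works for all targets [a] and [b]. *)
Lemma axis_wpd_pair r : exists N : nat, forall a b,
  finite_set [set v | d (act v o) a <= r /\ d (act v (pt N)) b <= r].
Proof.
have [N finN] := axis_wpd A (r + r); exists N => a b.
have [[v0 [v0a v0b]]|no] := pselect (exists v, d (act v o) a <= r /\ d (act v (pt N)) b <= r).
  apply: (sub_finite_set _ (finite_image (fun w => (v0 * w)%g) finN)) => v /= [va vb].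
  exists (v0^-1 * v)%g; last by rewrite mulgA mulgV mul1g.
  split; rewrite !(actM isom).
    rewrite metric_sym (dist_actV isom) invgK.
    by apply: le_trans (metric_triangle _ a _) _; rewrite lerD // metric_sym.
  rewrite (dist_actV isom) invgK.
  by apply: le_trans (metric_triangle _ b _) _; rewrite lerD // metric_sym.
have -> : [set v | d (act v o) a <= r /\ d (act v (pt N)) b <= r] = set0; last exact: finite_set0.
by apply/seteqP; split=> // v vP; case: no; exists v.
Qed.

(** A special path between the two points of [h O] stays near [h O], and contraction brings it near
    [O] at two times. Between these times it is near both orbits; [l1] and [l2] are its exponents
    along [h O] at these times. *)
Lemma axis_fellow : exists2 r, 0 <= r & forall h a b,
  C <= d (pi (act h (pt a))) (pi (act h (pt b))) ->
  exists l1 l2, [/\ d (act h (pt l1)) (pi (act h (pt a))) <= r,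
    d (act h (pt l2)) (pi (act h (pt b))) <= r
    & forall l, between l1 l2 l -> d (act h (pt l)) (pi (act h (pt l))) <= r].
Proof.
have C0 := axis_C_ge0.
have [D0 D0_ge0 HD0] := special_morse mu1 PSmu piP C.
have [c1 c1_ge0 Hc1] := axis_near C.
have [D1 D1_ge0 HD1] := special_morse_between c1.
have [r8 r8_ge0 Hr8] := axis_segment D0.
have [r2 r2_ge0 Hr2] := axis_near (r8 + D1).
exists (D0 + C + r2) => [|h a b far]; first by lra.
have [x [y [q [PSq qx qy]]]] := special_exists PSmu (act h (pt a)) (act h (pt b)).
rewrite -qx -qy in far *.
have [[s sxy ns] [t txy nt]] : (exists2 t, x <= t <= y & d (q t) (pi (q x)) <= C) /\
    (exists2 t, x <= t <= y & d (q t) (pi (q y)) <= C).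
  by case: piP => _ _ _; apply.
pose q' t := act h^-1%g (q t); have PSq' : PS x y q' by exact: PSact.
have near' u : x <= u <= y -> d (q' u) (pi (q' u)) <= D0.
  by apply: HD0 => //; rewrite /q' ?qx ?qy (actK isom) metric_sym axis_proj_pt.
have ends u z : x <= u <= y -> d (q u) (pi z) <= C ->
    d (act h (pt (iota (q' u)))) (pi z) <= D0 + C + r2.
  move=> uxy uz; have := near' u uxy; rewrite metric_sym /q' -(dist_actV isom) => nu.
  apply: le_trans (metric_triangle _ (q u) _) _.
  by rewrite -[_ + C + r2]addrA; apply: lerD => //; lra.
exists (iota (q' s)), (iota (q' t)); split; [exact: ends|exact: ends|move=> l lst].
have [u ust ul] := Hr8 _ _ _ PSq' _ _ sxy txy (near' s sxy) (near' t txy) l lst.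
have := HD1 _ _ _ PSq _ _ sxy txy (Hc1 _ _ ns) (Hc1 _ _ nt) u ust => nu.
suff : d (act h (pt l)) (pt (iota (q u))) <= r8 + D1 by move=> /Hr2; lra.
apply: le_trans (metric_triangle _ (q u) _) _; apply: lerD => //.
by rewrite (dist_actV isom) metric_sym.
Qed.

(** Normalizing [h g^l] on the left by the coordinate of [h g^l o] gives an element that keeps [o]
    near [o] and sends [g^N o] near some [g^e o] with [e] bounded. WPD leaves finitely many of them,
    independently of [h]. *)
Lemma axis_fellow_finite : exists r (N : nat) (F : set G), [/\ 0 <= r, finite_set F
  & forall h a b, C <= d (pi (act h (pt a))) (pi (act h (pt b))) ->
    exists l1 l2, [/\ d (act h (pt l1)) (pi (act h (pt a))) <= r,
      d (act h (pt l2)) (pi (act h (pt b))) <= r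
      & forall l, between l1 l2 l -> between l1 l2 (l + N) ->
        F (expgz g (- iota (act h (pt l))) * h * expgz g l)%g]].
Proof.
have [r r0 Hr] := axis_fellow; have [N finN] := axis_wpd_pair r.
have [rN rN0 HrN] := orbit_close qi N.
have [M M0 HM] := axis_coord_lip rN.
exists r, N, (\bigcup_(e in [set e : int | `|e| <= M])
  [set v | d (act v o) o <= r /\ d (act v (pt N)) (pt e) <= r]); split=> //.
  by apply: bigcup_finite => [|e _]; [exact: finite_int_ball|exact: finN].
move=> h a b /Hr[l1 [l2 [h1 h2 near]]]; exists l1, l2; split=> // l bl blN.
have nl := near _ bl; have nlN := near _ blN.
exists (iota (act h (pt (l + N))) - iota (act h (pt l))) => /=.
  by apply: HM; rewrite (act_dist isom); apply: HrN; rewrite addrC addKr.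
split; rewrite !(actM isom) (dist_actV isom) -expgzN opprK //.
by rewrite -(expgz_nat g N) !(act_orbit isom) [iota _ + _]addrC subrK.
Qed.

(** For [g] of infinite order this is membership in the commensurator of the subgroup generated by
    [g]. *)
Definition commensurates h : Prop :=
  exists m n : int, [/\ m != 0, n != 0 & (h * expgz g m)%g = (expgz g n * h)%g].

Lemma axis_coincidence_commensurates h (i j l l' : int) : l != l' ->
  (expgz g (- i) * h * expgz g l)%g = (expgz g (- j) * h * expgz g l')%g ->
  commensurates h.
Proof.
move=> ll' e; have e' : (h * expgz g (l - l'))%g = (expgz g (i - j) * h)%g.
  have := congr1 (fun z => expgz g i * z * expgz g (- l'))%g e.
  by rewrite !expgzD !expgzN !gnorm.
exists (l - l'), (i - j); split=> //; first by rewrite subr_eq0.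
apply: contra_neq ll' => ij; rewrite ij mul1g in e'.
apply/eqP; rewrite -subr_eq0; apply/eqP; apply: (expgz_eq1 axis_infinite_order).
by apply: (@mulgI _ h); rewrite e' mulg1.
Qed.

(* If h O projects to a long segment, then h fellow-travels O along it, and two of
   the finitely many values of g^(-i) h g^l coincide. *)
Lemma axis_bounded_projection : exists2 B, 0 <= B & forall h, ~ commensurates h ->
  forall a b, d (pi (act h (pt a))) (pi (act h (pt b))) <= B.
Proof.
have C0 := axis_C_ge0.
have [r [N [F [r0 finF HF]]]] := axis_fellow_finite.
have [n0 Hn0] := finite_set_pigeonhole finF.
(* A gap longer than [n0 + N] between [l1] and [l2] has room for the [n0 + 1] windows from [l] to
   [l + N] required by the pigeonhole principle. *)
have [rM rM0 HrM] := orbit_close qi (n0 + N)%N.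
exists (C + rM + 2 * r) => [|h nE a b]; first by lra.
have [//|far] := leP (d (pi (act h (pt a))) (pi (act h (pt b)))) (C + rM + 2 * r).
have [|l1 [l2 [h1 h2 Fl]]] := HF h a b; first by lra.
have l12 : (n0 + N)%:Z < `|l1 - l2|.
  rewrite ltNge; apply/negP => /HrM; rewrite -(act_dist isom h).
  triangle (pi (act h (pt a))) (act h (pt l1)) (act h (pt l2)).
  by triangle (pi (act h (pt a))) (pi (act h (pt b))) (act h (pt l2)); lra.
pose lo := Num.min l1 l2.
pose f (i : nat) := (expgz g (- iota (act h (pt (lo + i%:Z)))) * h * expgz g (lo + i%:Z))%g.
have [i in0|i [j [ij jn0 fij]]] := Hn0 f.
  by apply: Fl; rewrite -?addrA; apply: between_min; move: in0 (ltW l12); rewrite PoszD => *; lia.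
case: nE; apply: axis_coincidence_commensurates fij.
by apply/eqP => /addrI[e]; rewrite e ltnn in ij.
Qed.

Lemma commensuratesM h k : commensurates h -> commensurates k -> commensurates (h * k)%g.
Proof.
move=> [m [n [m0 n0 hmn]]] [p [q [p0 q0 kpq]]]; exists (p * m), (n * q).
split; rewrite ?mulf_neq0 // expgzM -mulgA (expgz_intertwine _ kpq) mulgA.
by rewrite -(expgzM g q m) (mulrC q m) (expgzM g m q) (expgz_intertwine _ hmn) -expgzM mulgA.
Qed.

Lemma commensuratesV h : commensurates h -> commensurates h^-1%g.
Proof.
move=> [m [n [m0 n0 hmn]]]; exists n, m; split=> //.
by apply: (@mulgI _ h); rewrite mulgA -(mulgK h (expgz g n)) -hmn !gnorm.
Qed.

Lemma commensurates_expgz n : commensurates (expgz g n).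
Proof. by exists 1, 1; split=> //; rewrite -!expgzD addrC. Qed.

(** From [h g^m = g^n h] the orbit [h O] follows [O] in both directions, so the fellow-travelling
    segment can be made to contain the exponents 0 and [N]. Then [g^(-i) h] lies in the finite set
    [F], which does not depend on [h]; passing to inverses gives multiples on the right. *)
Lemma axis_commensurator_cosets : exists2 F : set G, finite_set F &
  forall h, commensurates h -> exists n, F (h * expgz g n)%g.
Proof.
have C0 := axis_C_ge0.
have [r [N [F [r0 finF HF]]]] := axis_fellow_finite.
suff H h : commensurates h -> exists i, F (expgz g (- i) * h)%g.
  exists [set v^-1%g | v in F]; first exact: finite_image.
  move=> h /commensuratesV/H[i Fi]; exists i; exists (expgz g (- i) * h^-1)%g => //.
  by rewrite expgzN !gnorm.
move=> [m [n [m0 n0 hmn]]]; have [c c0 Hc] := axis_proj_equivariant.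
have trans k : act h (pt (m * k)) = act (expgz g (n * k)) (act h o).
  by rewrite -!(actM isom) !expgzM (expgz_intertwine _ hmn).
set j := iota (act h o); set rho := d (act h o) (pi (act h o)).
have pik k : d (pi (act h (pt (m * k)))) (pt (n * k + j)) <= c.
  by rewrite trans -(act_orbit isom); exact: Hc.
have hk k : d (act h (pt (m * k))) (pt (n * k + j)) <= rho.
  by rewrite trans -(act_orbit isom) (act_dist isom).
have [M1 M10 HM1] := orbit_far qi (C + 2 * c).
have [M2 M20 HM2] := orbit_far qi (r + c + rho).
have ends k l : d (act h (pt l)) (pi (act h (pt (m * k)))) <= r -> `|l - m * k| <= M2.
  move=> hl; apply: HM2; rewrite -(act_dist isom h).
  have := hk k; have := pik k; rewrite (metric_sym (act h (pt (m * k)))).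
  move: (metric_triangle (act h (pt l)) (pi (act h (pt (m * k)))) (act h (pt (m * k)))).
  move: (metric_triangle (pi (act h (pt (m * k)))) (pt (n * k + j)) (act h (pt (m * k)))).
  lra.
(* [M1] makes the projections of [h g^(-m k) o] and [h g^(m k) o] at least [C] apart; [M2] bounds
   the distance of [l1] and [l2] from [- m k] and [m k], so that 0 and [N] lie between them. *)
pose k : int := M1 + M2 + N%:Z + 1.
have far : C <= d (pi (act h (pt (m * - k)))) (pi (act h (pt (m * k)))).
  rewrite leNgt; apply/negP => close.
  have : `|(n * - k + j) - (n * k + j)| <= M1.
    apply: HM1; have := pik (- k); have := pik k; move: close.
    triangle (pt (n * - k + j)) (pi (act h (pt (m * - k)))) (pi (act h (pt (m * k)))).
    by triangle (pt (n * - k + j)) (pi (act h (pt (m * k)))) (pt (n * k + j)); lra.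
  have -> : (n * - k + j) - (n * k + j) = - (n * (2 * k)) by lia.
  rewrite normrN normrM => le1.
  have : 1 * `|2 * k| <= `|n| * `|2 * k| by rewrite ler_wpM2r // ; lia.
  rewrite /k in le1 *; lia.
have [l1 [l2 [/ends h1 /ends h2 Fl]]] := HF _ _ _ far.
exists (iota (act h (pt 0))); rewrite -[X in F X]mulg1; apply: Fl.
  have : 1 * `|k| <= `|m| * `|k| by rewrite ler_wpM2r //; lia.
  rewrite -normrM /between; move: h1 h2; rewrite mulrN /k; lia.
have : 1 * `|k| <= `|m| * `|k| by rewrite ler_wpM2r //; lia.
rewrite -normrM /between; move: h1 h2; rewrite mulrN /k; lia.
Qed.

(** Let [y] be the projection of [x] to [h O]; it projects to [O] near [h o]. If [x] does not, a
    special path from [x] to [y] passes near [pi x]. There it either still projects to [h O] like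
    [x], so that [x] projects there like a point of [O], or it is near [y], so that [pi x] is near
    [pi y]. *)
Lemma axis_behrstock : exists2 B, 0 <= B & forall h, ~ commensurates h -> forall x,
  d (pi x) (pi (act h o)) <= B \/ d (pi (act h^-1%g x)) (pi (act h^-1%g o)) <= B.
Proof.
have C0 := axis_C_ge0.
have [B B0 HB] := axis_bounded_projection.
have [D0 D0_ge0 HD0] := proj_along_path mu1 PSmu piP.
have [c1 c1_ge0 Hc1] := axis_proj_lip C.
have [c2 c2_ge0 Hc2] := axis_proj_lip (D0 + C).
exists (C + c1 + c2 + B) => [|h nE x]; first by lra.
have [?|far] := leP (d (pi x) (pi (act h o))) (C + c1 + c2 + B); [by left|].
have nEV : ~ commensurates h^-1%g by move=> /commensuratesV; rewrite invgK.
have HBo k n : ~ commensurates k -> d (pi (act k (pt n))) (pi (act k o)) <= B.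
  by move=> nEk; have := HB k nEk n 0; rewrite (act_orbit0 isom).
pose y := act h (pi (act h^-1%g x)).
have yo : d (pi y) (pi (act h o)) <= B by exact: HBo.
have [a [b [q [PSq qa qb]]]] := special_exists PSmu x y.
have [] : (exists2 t, a <= t <= b & d (q t) (pi (q a)) <= C) /\
    (exists2 t, a <= t <= b & d (q t) (pi (q b)) <= C).
  case: piP => _ _ _; apply=> //; rewrite qa qb.
  by triangle (pi x) (pi y) (pi (act h o)); lra.
rewrite qa => -[t tab qt] _.
have := HD0 _ _ _ (PSact h^-1%g PSq); rewrite qb /y (actK isom) qa => /(_ erefl _ tab)[pt|qty].
  right; have := Hc1 (act h^-1%g (q t)) (act h^-1%g (pi x)).
  rewrite (act_dist isom) => /(_ qt).
  have := HBo _ (iota x) nEV; rewrite -[X in act _ X]/(pi x).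
  triangle (pi (act h^-1%g x)) (pi (act h^-1%g (q t))) (pi (act h^-1%g (pi x))).
  by triangle (pi (act h^-1%g x)) (pi (act h^-1%g (pi x))) (pi (act h^-1%g o)); lra.
left; have hxy := Hc2 (pi x) y.
have /hxy : d (pi x) y <= D0 + C.
  apply: le_trans (metric_triangle _ (q t) _) _.
  rewrite (addrC D0) (metric_sym (pi x)); apply: lerD => //.
  by rewrite metric_sym /y (dist_actV isom) metric_sym.
have := axis_proj_id (axis_proj_orbit x).
triangle (pi x) (pi (pi x)) (pi y).
by triangle (pi x) (pi y) (pi (act h o)); lra.
Qed.

(** A special path from [x] to [y] runs close to each such translate [v O] along more than [N]
    exponents, hence passes near [v g^m o] and [v g^(m + N) o] for some [m]. Its finitely many
    samples give finitely many pairs of targets, and WPD finitely many [v g^m] for each pair. *)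
Lemma axis_wide_translates_finite : exists2 c, 0 <= c & forall x y,
  exists2 F, finite_set F & forall v,
    c <= d (pi (act v^-1%g x)) (pi (act v^-1%g y)) -> exists m, F (v * expgz g m)%g.
Proof.
have C0 := axis_C_ge0; move: mu1 => mu_ge1.
have [c1 c1_ge0 Hc1] := axis_near C.
have [r8 r8_ge0 Hr8] := axis_segment c1.
have [N finN] := axis_wpd_pair (r8 + (mu + mu)).
have [rN rN0 HrN] := orbit_close qi N.
have [c2 c2_ge0 Hc2] := axis_proj_lip C.
exists (C + rN + 2 * c2 + 2 * C + 1) => [|x y]; first by lra.
have [a [b [q [PSq qa qb]]]] := special_exists PSmu x y.
have [n [u [_ _ uab _ [unet _]]]] := special_walk mu1 PSmu PSq.
exists (\bigcup_(i in `I_n.+1) \bigcup_(j in `I_n.+1)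
  [set v | d (act v o) (q (u i)) <= r8 + (mu + mu) /\
           d (act v (pt N)) (q (u j)) <= r8 + (mu + mu)]).
  apply: bigcup_finite => [|i _]; first exact: finite_II.
  by apply: bigcup_finite => [|j _]; [exact: finite_II|exact: finN].
move=> v far; pose q' t := act v^-1%g (q t); have PSq' : PS a b q' by exact: PSact.
have [] : (exists2 t, a <= t <= b & d (q' t) (pi (q' a)) <= C) /\
    (exists2 t, a <= t <= b & d (q' t) (pi (q' b)) <= C).
  by case: piP => _ _ _; apply=> //; rewrite /q' qa qb; lra.
rewrite /q' qa qb => -[s sab hs] [t tab ht].
have projs z w : d z (pi w) <= C -> d (pi z) (pi w) <= c2 + C.
  move=> zw; apply: le_trans (metric_triangle _ (pi (pi w)) _) _.
  by apply: lerD; [exact: Hc2|exact: axis_proj_id (axis_proj_orbit w)].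
have gap : N%:Z < `|iota (q' s) - iota (q' t)|.
  rewrite ltNge; apply/negP => /HrN; have := projs _ _ hs; have := projs _ _ ht.
  rewrite -/(q' s) -/(q' t) -/(pi (q' s)) -/(pi (q' t)).
  triangle (pi (act v^-1%g x)) (pi (q' s)) (pi (q' t)).
  by triangle (pi (act v^-1%g x)) (pi (q' t)) (pi (act v^-1%g y)); lra.
have hit k : between (iota (q' s)) (iota (q' t)) k -> exists2 i, (i < n.+1)%N &
    d (act v (pt k)) (q (u i)) <= r8 + (mu + mu).
  move=> /(Hr8 _ _ _ PSq' _ _ sab tab (Hc1 _ _ hs) (Hc1 _ _ ht))[w stw wk].
  have [i i_n wi] := unet w ltac:(lra); exists i => //.
  apply: le_trans (metric_triangle _ (q w) _) _; apply: lerD => //.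
  by rewrite (dist_actV isom) metric_sym.
have [|i i_n hi] := hit (Num.min (iota (q' s)) (iota (q' t))).
  by rewrite -[X in between _ _ X]addr0 between_min // lexx normr_ge0.
have [|j j_n hj] := hit (Num.min (iota (q' s)) (iota (q' t)) + N).
  by rewrite between_min // (ltW gap).
exists (Num.min (iota (q' s)) (iota (q' t))), i => //; exists j => //.
by split; rewrite (actM isom) ?(act_orbit isom).
Qed.

End Axis.

(** * Chains of axes *)

Lemma bounded_prefix (R : realType) (f : nat -> R) k :
  exists2 M, 0 <= M & forall r, (r < k)%N -> f r <= M.
Proof.
elim: k => [|k [M M0 HM]]; first by exists 0.
exists (Num.max M (f k)) => [|r]; first by rewrite le_max M0.
rewrite ltnS leq_eqVlt => /orP[/eqP->|/HM]; first by rewrite le_max lexx orbT.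
by rewrite le_max => ->.
Qed.

Section BeadChain.
Variables (R : realType) (G : groupType) (X : metricType R) (act : G -> X -> X).
Variables (PS : path_family X) (mu : R).
Hypotheses (mu1 : 1 <= mu) (PSmu : path_system_with mu PS).
Hypotheses (isom : isometric_action act) (PSact : preserves_paths act PS).
Variables (g : G) (o : X) (C : R) (iota : X -> int).
Hypothesis A : is_axis act PS g o C iota.
Local Notation d := mdist.
Local Notation pt n := (act (expgz g n) o).
Local Notation pi := (axis_proj act g o iota).

(** [h i] is a prefix of the bi-infinite periodic word: the axis [h i O] is entered at [h i o] and
    left near [h i g^(n i) o]. By [back], a point past one axis is seen from the preceding one at
    its exit. The lower bounds on [T] keep entry and exit apart for the level estimates, for
    contraction and for WPD. *)
Variables (W : G) (k : nat) (h : int -> G) (n : int -> int) (c0 c2 c3 cw T : R).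
Hypotheses (k0 : (0 < k)%N) (hW : forall i : int, h (i + k) = (W * h i)%g).
Hypothesis back : forall i x, c0 < d (pi (act (h (i + 1))^-1%g x)) o ->
  d (pi (act (h i)^-1%g x)) (pt (n i)) <= c2.
Hypothesis forth : forall i, d (pi (act (h i)^-1%g (act (h (i + 1)) o))) (pt (n i)) <= c2.
Hypothesis long : forall i, T <= d o (pt (n i)).
Hypothesis pi_step : forall x y, d x y <= mu + mu -> d (pi x) (pi y) <= c3.
Hypothesis wide : forall x y, exists2 F, finite_set F & forall v,
    cw <= d (pi (act v^-1%g x)) (pi (act v^-1%g y)) -> exists m, F (v * expgz g m)%g.
Hypotheses (c3_ge0 : 0 <= c3) (Cc0 : C <= c0).
Hypotheses (T_step : c0 + c2 + c3 + c0 < T) (TC : c0 + c2 + C <= T) (Tw : c0 + c2 + cw <= T).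

Let constants : [/\ 0 <= C, 0 <= c0 /\ 0 <= c3, C <= c0, c0 + c2 + c3 + c0 < T
  & c0 + c2 + C <= T /\ c0 + c2 + cw <= T].
Proof. by have C0 := axis_C_ge0 A; do ?split=> //; apply: le_trans C0 Cc0. Qed.

(* The projection of x to the i-th axis h_i O is far from the entry point h_i o of
   the chain, so that x lies on the far side of that axis. *)
Definition beyond (i : int) (x : X) : Prop := c0 < d (pi (act (h i)^-1%g x)) o.

(** With [y = x] this is monotonicity in [i]; applied in both directions it lets the number of
    passed axes change by at most 1 per sample of a path. *)
Lemma beyond_step i x y : d x y <= mu + mu -> beyond (i + 1) x -> beyond i y.
Proof.
have [? [? ?] ? ? [? ?]] := constants.
move=> xy /back xi; rewrite /beyond.
have := pi_step (x := act (h i)^-1%g x) (y := act (h i)^-1%g y).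
rewrite (act_dist isom) => /(_ xy); have := long i.
triangle o (pi (act (h i)^-1%g y)) (pt (n i)).
triangle (pi (act (h i)^-1%g y)) (pi (act (h i)^-1%g x)) (pt (n i)).
lra.
Qed.

Lemma beyond_le i j x : i <= j -> beyond j x -> beyond i x.
Proof.
move=> ij; have -> : j = i + `|j - i|%N by lia.
elim: `|j - i|%N => [|m IH]; first by rewrite addr0.
rewrite -addn1 PoszD addrA => /beyond_step bm; apply/IH/bm.
by rewrite mdistxx addr_ge0 // (le_trans ler01).
Qed.

Definition level (x : X) (z : int) : Prop := beyond z x /\ ~ beyond (z + 1) x.

Lemma level_beyond x z i : level x z -> beyond i x <-> i <= z.
Proof.
move=> [bz nbz]; split=> [bi|/beyond_le]; last by apply.
rewrite leNgt; apply/negP => zi; apply: nbz; apply: beyond_le bi; lia.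
Qed.

Lemma level_unique x z z' : level x z -> level x z' -> z = z'.
Proof.
move=> lz lz'; apply/le_anti/andP; split.
  by apply/(level_beyond z lz'); case: lz.
by apply/(level_beyond z' lz); case: lz'.
Qed.

Lemma level_step x y z : d x y <= mu + mu -> level x z ->
  exists2 z', level y z' & `|z' - z| <= 1.
Proof.
move=> xy [bz nbz]; have yx : d y x <= mu + mu by rewrite metric_sym.
have b1 : beyond (z - 1) y by apply: beyond_step xy _; rewrite subrK.
have b2 : ~ beyond (z + 1 + 1) y by move=> /(beyond_step yx).
have [by1|nby1] := pselect (beyond (z + 1) y).
  by exists (z + 1) => //; lia.
have [by0|nby0] := pselect (beyond z y); first by exists z => //; lia.
by exists (z - 1); [split=> //; rewrite subrK|lia].
Qed.

Lemma level_walk (z : nat -> X) l j :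
  (forall i, d (z i) (z i.+1) <= mu + mu) -> level (z 0%N) l ->
  exists2 l', level (z j) l' & `|l' - l| <= j.
Proof.
move=> zstep l0; elim: j => [|j [l' ll' ?]]; first by exists l; rewrite ?subrr.
by have [l'' ? ?] := level_step (zstep j) ll'; exists l'' => //; lia.
Qed.

(** The entry point of an axis projects to itself up to [C <= c0], so it has not passed its own
    axis; this is the origin of the shift by 1. *)
Lemma level_bead i : level (act (h i) o) (i - 1).
Proof.
have [? [? ?] ? ? [? ?]] := constants.
rewrite /level /beyond subrK (actK isom); split; last first.
  have := axis_proj_pt A 0; rewrite (act_orbit0 isom) => ?.
  by apply/negP; rewrite -leNgt; lra.
have := forth (i - 1); rewrite subrK.
have := long (i - 1); triangle o (pi (act (h (i - 1))^-1%g (act (h i) o))) (pt (n (i - 1))).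
lra.
Qed.

(** It is not clear beforehand that a point has passed some axis but not all. A level is carried
    along a sampled special path from a point that has one, and counting samples gives the Lipschitz
    bound. *)
Lemma level_between x y l : level x l ->
  exists2 l', level y l' & `|l' - l|%:~R <= mu * (d x y + mu) + 1.
Proof.
move=> lx; have [a [b [q [PSq qa qb]]]] := special_exists PSmu x y.
have [j [u [u0 uj uab ustep [_ jab]]]] := special_walk mu1 PSmu PSq.
have ab := special_le PSmu PSq.
have [l' ll' l'j] : exists2 l', level (q (u j)) l' & `|l' - l| <= j.
  by apply: (level_walk (z := q \o u)) => //=; rewrite u0 qa.
rewrite uj qb in ll'; exists l' => //.
have : `|a - b| <= mu * (d x y + mu).
  by rewrite -qa -qb; apply: (special_lower mu1 PSmu PSq); rewrite ?lexx ?ab.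
rewrite ler_norml => /andP[? ?]; apply: (@le_trans _ _ j%:R); last lra.
by rewrite -(ler_int R) in l'j.
Qed.

Lemma level_exists x : exists z, level x z.
Proof. by have [z ? _] := level_between x (level_bead 0); exists z. Qed.

Definition bead_level x : int := projT1 (cid (level_exists x)).

Lemma bead_levelP x : level x (bead_level x).
Proof. by rewrite /bead_level; case: cid. Qed.

Lemma beyondP i x : beyond i x <-> i <= bead_level x.
Proof. exact: level_beyond (bead_levelP x). Qed.

Lemma bead_level_bead i : bead_level (act (h i) o) = i - 1.
Proof. exact: level_unique (bead_levelP _) (level_bead i). Qed.

Lemma bead_level_lip x y : `|bead_level x - bead_level y|%:~R <= mu * (d x y + mu) + 1.
Proof.
have [l ll] := level_between y (bead_levelP x).
by rewrite (level_unique ll (bead_levelP y)) distrC.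
Qed.

Lemma bead_periodic i (m : int) : h (i + m * k%:Z) = (expgz W m * h i)%g.
Proof.
elim: m => [|m IH|m IH]; first by rewrite mul0r addr0 mul1g.
  rewrite -addn1 PoszD mulrDl mul1r addrA hW IH mulgA; congr (_ * _)%g.
  by rewrite addrC expgzD.
have := hW (i + - m.+1%:Z * k); rewrite (_ : _ + k%:Z = i + - m%:Z * k); last by lia.
rewrite IH => e; apply: (@mulgI _ W); rewrite -e mulgA; congr (_ * _)%g.
by rewrite -{2}(expgz1 W) -expgzD; congr expgz; lia.
Qed.

Lemma bead_level_translate (m : int) x :
  bead_level (act (expgz W m) x) = bead_level x + m * k%:Z.
Proof.
apply: level_unique (bead_levelP _) _.
have tr z : beyond (z + m * k%:Z) (act (expgz W m) x) <-> beyond z x.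
  by rewrite /beyond bead_periodic invgM (actM isom) (actK isom).
rewrite /level addrAC; split; first by apply/tr; apply/beyondP.
by move/tr/beyondP; lia.
Qed.

(** On the [i]-th axis one endpoint projects near the entry and the other near the exit, so
    contraction applies. Strictness on the upper side matters: [back] speaks only of points that
    have passed the axis [i + 1]. *)
Lemma bead_passed a b q i : PS a b q ->
  (bead_level (q a) < i < bead_level (q b)) || (bead_level (q b) < i < bead_level (q a)) ->
  exists2 t, a <= t <= b & d (q t) (act (h i) o) <= C + c0.
Proof.
have [? [? ?] ? ? [? ?]] := constants; move=> PSq iq.
pose q' t := act (h i)^-1%g (q t).
have PSq' : PS a b q' by exact: PSact.
have before x : bead_level x < i -> d (pi (act (h i)^-1%g x)) o <= c0.
  by move=> xi; rewrite leNgt; apply/negP => /beyondP; lia.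
have after x : i < bead_level x -> d (pi (act (h i)^-1%g x)) (pt (n i)) <= c2.
  by move=> xi; apply/back/beyondP; lia.
have apart x y : bead_level x < i -> i < bead_level y ->
    C <= d (pi (act (h i)^-1%g x)) (pi (act (h i)^-1%g y)).
  move=> /before ? /after ?; have := long i.
  triangle o (pi (act (h i)^-1%g x)) (pi (act (h i)^-1%g y)).
  triangle o (pi (act (h i)^-1%g y)) (pt (n i)); lra.
have close t x : d (q' t) (pi (act (h i)^-1%g x)) <= C -> bead_level x < i ->
    d (q t) (act (h i) o) <= C + c0.
  move=> tx /before xo; rewrite metric_sym (dist_actV isom) metric_sym.
  by apply: le_trans (metric_triangle _ (pi (act (h i)^-1%g x)) _) _; apply: lerD.
have contr : C <= d (pi (q' a)) (pi (q' b)) ->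
    (exists2 t, a <= t <= b & d (q' t) (pi (q' a)) <= C) /\
    (exists2 t, a <= t <= b & d (q' t) (pi (q' b)) <= C).
  by case: (axis_projection A) => _ _ _; apply.
case/orP: iq => /andP[lo hi].
  have [[t tab qt] _] := contr (apart _ _ lo hi).
  by exists t => //; apply: close qt lo.
have [|_ [t tab qt]] := contr; first by rewrite metric_sym; exact: apart.
by exists t => //; apply: close qt lo.
Qed.

Local Notation p := (act (h 0) o).

(** One period of [W] contains [k] axes, and the level of [W^m p] is [m k - 1]; adding 1 makes its
    coordinate exactly [m]. *)
Definition bead_coord (x : X) : int := ((bead_level x + 1) %/ k%:Z)%Z.

Lemma bead_coord_orbit m : bead_coord (act (expgz W m) p) = m.
Proof.
rewrite /bead_coord bead_level_translate bead_level_bead addrAC subrK add0r mulzK //.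
by rewrite eqz_nat -lt0n.
Qed.

Lemma bead_split i : exists2 r : nat, (r < k)%N & h i = (expgz W (i %/ k%:Z)%Z * h r)%g /\
  h (i + 1) = (expgz W (i %/ k%:Z)%Z * h (r%:Z + 1))%g.
Proof.
have kz : k%:Z != 0 by rewrite eqz_nat -lt0n.
have rk : `|(i %% k%:Z)%Z|%N%:Z = (i %% k%:Z)%Z by rewrite gez0_abs // modz_ge0.
exists `|(i %% k%:Z)%Z|%N; first by rewrite -ltz_nat rk ltz_pmod // ltz_nat.
rewrite -!bead_periodic rk; split; congr h.
  by rewrite addrC -divz_eq.
by rewrite addrAC [_ + _ * _]addrC -divz_eq.
Qed.

Lemma bead_coord_close : exists2 r, 0 <= r & forall x m,
  (m <= 4)%N ->
  d (act (h (bead_level x + 1 - m%:Z)) o) (axis_proj act W p bead_coord x) <= r /\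
  d (act (h (bead_level x + 1 + m%:Z)) o) (axis_proj act W p bead_coord x) <= r.
Proof.
have [r r0 Hr] := bounded_prefix (fun r => d (act (h r) o) p) k.
have [s s0 Hs] := bounded_prefix (fun r => d (act (h r) o) (act (h (r%:Z + 1)) o)) k.
have step i : d (act (h i) o) (act (h (i + 1)) o) <= s.
  have [j jk [-> ->]] := bead_split i.
  by rewrite !(actM isom) (act_dist isom); exact: Hs.
have steps i (m : nat) : d (act (h i) o) (act (h (i + m)) o) <= m%:R * s.
  elim: m => [|m IH]; first by rewrite addr0 mdistxx mul0r.
  apply: le_trans (metric_triangle _ (act (h (i + m)) o) _) _.
  by rewrite -natr1 mulrDl mul1r lerD // -addn1 PoszD addrA.
have base x : d (act (h (bead_level x + 1)) o) (axis_proj act W p bead_coord x) <= r.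
  rewrite /axis_proj /bead_coord; have [j jk [-> _]] := bead_split (bead_level x + 1).
  by rewrite (actM isom) (act_dist isom); exact: Hr.
exists (4 * s + r) => [|x m m4]; first by lra.
have ms : m%:R * s <= 4 * s by rewrite ler_wpM2r // ler_nat.
split; apply: le_trans (metric_triangle _ (act (h (bead_level x + 1)) o) _) _; apply: lerD => //;
  apply: le_trans ms.
  by have := steps (bead_level x + 1 - m%:Z) m; rewrite subrK.
by rewrite metric_sym.
Qed.

Lemma bead_quasi_geodesic : quasi_geodesic_orbit act W p.
Proof.
move: mu1 => mu_ge1; set e := d p (act W p); have e0 : 0 <= e by exact: mdist_ge0.
exists (mu + e), (mu + 1); split; [lra|lra|move=> m m'].
have up := orbit_lipschitz isom W p m m'; rewrite -/e in up.
have := bead_level_lip (act (expgz W m) p) (act (expgz W m') p).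
set D := d _ _ in up *; have D0 : 0 <= D by exact: mdist_ge0.
rewrite !bead_level_translate -[X in `|X|]/(_ + _ - _) opprD addrACA subrr add0r -mulrBl.
rewrite -intrB -intr_norm; set x := `|m - m'| in up * => low.
have x0 : 0 <= x by rewrite normr_ge0.
have xR : 0 <= x%:~R :> R by rewrite ler0z.
have xle : x%:~R <= mu * (D + mu) + 1 :> R.
  apply: le_trans low; rewrite ler_int normrM; move: x0 k0; rewrite /x; clear; nia.
have xm : 0 <= x%:~R * mu :> R by rewrite mulr_ge0 //; lra.
apply/andP; split; last by lra.
rewrite lerBlDr ler_pdivrMr; last by lra.
have : 0 <= e * (D + (mu + 1)) by rewrite mulr_ge0 //; lra.
lra.
Qed.

(** Points whose levels differ by at most 2 have close projections. Otherwise the bead just above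
    the lower level and the bead just below the higher one both lie strictly between the levels, so
    a special path passes near them, and they are close to the two projections. *)
Lemma bead_projection : exists C',
  projection PS C' (cyclic_orbit act W p) (axis_proj act W p bead_coord).
Proof.
have [C_0 [c0_0 _] _ _ _] := constants.
have [r r0 Hr] := bead_coord_close.
pose piW := axis_proj act W p bead_coord.
have same x y : `|bead_level x - bead_level y| <= 2 -> d (piW x) (piW y) <= 2 * r.
  wlog xy : x y / bead_level x <= bead_level y => [Wl|].
    have [/Wl//|/ltW/Wl] := leP (bead_level x) (bead_level y).
    by rewrite distrC (metric_sym (piW x)).
  move=> h2; have [|_ hx] := Hr x `|bead_level y - bead_level x|%N; first by lia.
  have [//|_ hy] := Hr y 0%N.
  have e : bead_level x + 1 + `|bead_level y - bead_level x|%N = bead_level y + 1 + 0%N by lia.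
  rewrite e in hx; rewrite -/(piW x) -/(piW y) in hx hy.
  by move: hx hy; triangle (piW x) (act (h (bead_level y + 1 + 0%N)) o) (piW y); lra.
exists (2 * r + C + c0 + r + 1); split=> [|x|_ [m _ <-]|a b q PSq far]; first by lra.
- by exists (bead_coord x).
- by rewrite /axis_proj bead_coord_orbit mdistxx; lra.
have gap : 2 < `|bead_level (q a) - bead_level (q b)|.
  by rewrite ltNge; apply/negP => /same; rewrite /piW; lra.
have visit i x : (bead_level (q a) < i < bead_level (q b)) ||
    (bead_level (q b) < i < bead_level (q a)) ->
    d (act (h i) o) (piW x) <= r ->
    exists2 t, a <= t <= b & d (q t) (piW x) <= 2 * r + C + c0 + r + 1.
  move=> /(bead_passed PSq)[t tab ti] ix; exists t => //.
  by apply: le_trans (metric_triangle _ (act (h i) o) _) _; lra.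
have [lt|ge] := ltP (bead_level (q a)) (bead_level (q b)).
  split.
    apply: (visit (bead_level (q a) + 1 + 0%N)); last by have [] := Hr (q a) 0%N.
    by lia.
  apply: (visit (bead_level (q b) + 1 - 2%N%:Z)); last by have [] := Hr (q b) 2%N.
  by lia.
split.
  apply: (visit (bead_level (q a) + 1 - 2%N%:Z)); last by have [] := Hr (q a) 2%N.
  by lia.
apply: (visit (bead_level (q b) + 1 + 0%N)); last by have [] := Hr (q b) 0%N.
by lia.
Qed.

(* If v moves p and W^N p by at most r, then some middle axis v h_i O of the
   translated chain has far apart projections of p and W^N p. *)
Lemma bead_wpd r : exists N : nat, finite_set [set v : G | d p (act v p) <= r /\
  d (act (v * W ^+ N)%g p) (act (W ^+ N)%g p) <= r].
Proof.
have [? [? ?] ? ? [? ?]] := constants; move: mu1 => mu_ge1.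
pose Q := (Num.truncn `|mu * (r + mu) + 1|).+1.
have lipQ x y : d x y <= r -> `|bead_level x - bead_level y| <= Q.
  move=> xy; rewrite -(ler_int R); apply: le_trans (bead_level_lip x y) _.
  have : mu * (d x y + mu) <= mu * (r + mu) by rewrite ler_wpM2l //; lra.
  have /andP[_ /ltW] := truncn_itv (normr_ge0 (mu * (r + mu) + 1)).
  have := ler_norm (mu * (r + mu) + 1).
  by rewrite -[Q%:~R]/(Q%:R); rewrite /Q; lra.
(* [Q] bounds the change of level under a displacement of at most [r]. The axis [i = Q] is above
   [v^-1 p], of level at most [Q - 1], and below [v^-1 y], of level at least [Q + 3]. *)
exists (2 * Q + 4)%N; set N := (2 * Q + 4)%N; set y := act (W ^+ N)%g p.
have [F finF HF] := wide p y.
have yE : bead_level y = N%:Z * k%:Z - 1.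
  by rewrite /y -expgz_nat bead_level_translate bead_level_bead addrC.
pose i : int := Q%:Z.
apply: (sub_finite_set (B := \bigcup_(f in F)
  [set v | (exists m, (v * h i * expgz g m)%g = f) /\ d p (act v p) <= r])).
  move=> v /= [vp vy].
  have lx : bead_level (act v^-1%g p) < i.
    have := lipQ p (act v^-1%g p); rewrite -(dist_actV isom) metric_sym => /(_ vp).
    rewrite bead_level_bead /i; move: (bead_level _) => z; clear; lia.
  have ly : i < bead_level (act v^-1%g y).
    have := lipQ y (act v^-1%g y); rewrite -(dist_actV isom) -(actM isom) => /(_ vy).
    rewrite yE /i /N; move: (bead_level _) k0 => z; clear; nia.
  have [|m Fm] := HF (v * h i)%g.
    rewrite invgM !(actM isom).
    have : ~ beyond i (act v^-1%g p) by move/beyondP; rewrite leNgt lx.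
    move/negP; rewrite -leNgt.
    have : beyond (i + 1) (act v^-1%g y) by apply/beyondP; rewrite lezD1.
    move=> /back; have := long i.
    set x' := pi _; set y' := pi _.
    by triangle o x' y'; triangle o x' (pt (n i)); lra.
  by exists (v * h i * expgz g m)%g => //=; split=> //; exists m.
(* The coset [f] determines [v] up to a power of [g], and the bound on the displacement of [p]
   leaves finitely many exponents. *)
apply: bigcup_finite => // f _.
have [M M0 HM] := orbit_far (axis_qi A) (r + d (act f^-1%g p) o + d (act (h i)^-1%g p) o).
apply: (sub_finite_set _ (finite_image (fun m => f * expgz g (- m) * (h i)^-1)%g
  (finite_int_ball M))) => v /= [[m vf] vp]; exists m; last by rewrite -vf expgzN !gnorm.
have := HM (- m) 0; rewrite subr0 normrN (act_orbit0 isom); apply.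
have vE : (v = f * expgz g (- m) * (h i)^-1)%g by rewrite -vf expgzN !gnorm.
rewrite vE metric_sym !(actM isom) (dist_actV isom) in vp.
apply: le_trans (metric_triangle _ (act (expgz g (- m)) (act (h i)^-1%g p)) _) _.
rewrite (act_dist isom) (metric_sym o) addrC; apply: lerD => //.
by apply: le_trans (metric_triangle _ (act f^-1%g p) _) _; apply: lerD.
Qed.

Lemma bead_axis : exists C', is_axis act PS W p C' bead_coord.
Proof.
have [C' P] := bead_projection; exists C'; split=> //; first exact: bead_quasi_geodesic.
exact: bead_wpd.
Qed.

End BeadChain.

Lemma finite_set_bounded (R : realType) (T : choiceType) (F : set T) (f : T -> R) :
  finite_set F -> exists2 M, 0 <= M & forall x, F x -> f x <= M.
Proof.
move=> /finite_seqP[s ->]; elim: s => [|y s [M M0 HM]]; first by exists 0.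
exists (Num.max M (f y)) => [|x]; first by rewrite le_max M0.
rewrite /= inE => /orP[/eqP->|/HM]; first by rewrite le_max lexx orbT.
by rewrite le_max => ->.
Qed.

(** * Projection distance as a function on the group, and axes of words *)

Section Displacement.
Variables (R : realType) (G : groupType) (X : metricType R) (act : G -> X -> X).
Variables (PS : path_family X) (mu : R).
Hypotheses (mu1 : 1 <= mu) (PSmu : path_system_with mu PS).
Hypotheses (isom : isometric_action act) (PSact : preserves_paths act PS).
Variables (g : G) (o : X) (C : R) (iota : X -> int).
Hypothesis A : is_axis act PS g o C iota.
Local Notation d := mdist.
Local Notation pt n := (act (expgz g n) o).
Local Notation pi := (axis_proj act g o iota).

(** Expresses the Behrstock inequality as an alternative between group elements, the form used both
    to choose words and to partition the group for the mean. *)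
Definition proj_shift (h : G) : R := d (pi (act h o)) o.
Local Notation rho := proj_shift.

Lemma proj_shift_ge0 h : 0 <= rho h. Proof. exact: mdist_ge0. Qed.

Lemma proj_shift_alternative : exists2 B, 0 <= B & forall h x, ~ commensurates g h ->
  rho x <= B + rho h \/ rho (h^-1 * x)%g <= B + rho h^-1%g.
Proof.
have [B B0 HB] := axis_behrstock mu1 PSmu isom PSact A; exists B => // h x nE.
have [near|near] := HB h nE (act x o); [left|right]; rewrite /rho ?(actM isom);
  apply: le_trans (metric_triangle _ _ _) _; last by apply: lerD near (lexx _).
exact: lerD near (lexx _).
Qed.

Lemma proj_shiftMr t : exists2 c, 0 <= c & forall u, rho (u * t)%g <= c + rho u.
Proof.
have [c c0 Hc] := axis_proj_lip mu1 PSmu A (d (act t o) o).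
exists c => // u; apply: le_trans (metric_triangle _ (pi (act u o)) _) _.
by apply: lerD => //; apply: Hc; rewrite (actM isom) (act_dist isom).
Qed.

(** Since the projection commutes coarsely with [g^n], a large power of [g] cannot keep the
    projection near [o]. *)
Lemma proj_shift_expgzM : exists2 c, 0 <= c & forall n h,
  d o (pt n) <= c + rho h + rho (expgz g n * h)%g.
Proof.
have [c c0 Hc] := axis_proj_equivariant mu1 PSmu isom PSact A; exists c => // n h.
have := Hc n (act h o); rewrite /rho (actM isom) -[d (pi (act h o)) o](act_dist isom (expgz g n)).
triangle o (pi (act (expgz g n) (act h o))) (act (expgz g n) (pi (act h o))).
by triangle o (act (expgz g n) (pi (act h o))) (pt n); lra.
Qed.

(** For [u] in the commensurator [u o] is uniformly near [O], and [h O] has bounded projection. *)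
Lemma proj_shift_commensurates : exists2 c, 0 <= c & forall h u,
  ~ commensurates g h -> commensurates g u -> rho (h * u)%g <= c + rho h.
Proof.
have [F finF HF] := axis_commensurator_cosets mu1 PSmu isom PSact A.
have [M M0 HM] := finite_set_bounded (fun f => d (act f^-1%g o) o) finF.
have [B B0 HB] := axis_bounded_projection mu1 PSmu isom PSact A.
have [c c0 Hc] := axis_proj_lip mu1 PSmu A M.
exists (c + B) => [|h u nE /commensuratesV/HF[n /HM]]; first by lra.
rewrite invgM invgK (actM isom) (dist_actV isom) invgK => un.
have := HB h nE n 0; rewrite (act_orbit0 isom).
have := Hc (act h (act u o)) (act h (pt n)); rewrite (act_dist isom) => /(_ un).
rewrite /rho (actM isom); triangle (pi (act h (act u o))) (pi (act h (pt n))) (pi (act h o)).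
by triangle (pi (act h (act u o))) (pi (act h o)) o; lra.
Qed.

(** [T] depends on [D] alone, so exponents can be fixed before the letters [f i] are. The separation
    of consecutive axes is the Behrstock inequality for the inverse of [g^(n i) f i]. *)
Lemma chain_axis D : exists T, forall (W : G) (k : nat) (h : int -> G) (n : int -> int)
    (f : int -> G), (0 < k)%N -> (forall i : int, h (i + k) = (W * h i)%g) ->
  (forall i, h (i + 1) = (h i * (expgz g (n i) * f i))%g) ->
  (forall i, ~ commensurates g (f i)) ->
  (forall i, rho (f i) <= D) -> (forall i, rho (f i)^-1%g <= D) ->
  (forall i, T <= d o (pt (n i))) ->
  exists o' C' iota', is_axis act PS W o' C' iota'.
Proof.
have C0 := axis_C_ge0 A.
have [c c_ge0 Hc] := axis_proj_equivariant mu1 PSmu isom PSact A.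
have [B1 B1_ge0 HB1] := axis_behrstock mu1 PSmu isom PSact A.
have [B B_ge0 HB] := axis_bounded_projection mu1 PSmu isom PSact A.
have [c3 c3_ge0 Hc3] := axis_proj_lip mu1 PSmu A (mu + mu).
have [cw cw_ge0 Hw] := axis_wide_translates_finite mu1 PSmu isom PSact A.
(* [B1] is the Behrstock constant. [B + D] bounds the distance from the entry to the projection of
   the preceding base point, and [c + D] that from the exit to the projection of the next one; [C]
   ensures [C <= c0]. *)
pose c0 := B1 + B + D + C; pose c2 := B1 + B + c + D.
exists (c0 + c2 + c3 + c0 + C + cw + 1) => W k h n f k0 hW hS nE fD fVD long.
have D0 : 0 <= D := le_trans (proj_shift_ge0 (f 0)) (fD 0).
have c0_ge0 : 0 <= c0 by rewrite /c0; lra.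
pose u i := (expgz g (n i) * f i)%g.
have nEu i : ~ commensurates g (u i)^-1%g.
  move=> /commensuratesV; rewrite invgK /u => Eu; apply: (nE i).
  rewrite -(mulKg (expgz g (n i)) (f i)) -expgzN.
  exact: commensuratesM (commensurates_expgz _ _) Eu.
have uo i : d (pi (act (u i) o)) (pt (n i)) <= c + D.
  rewrite /u (actM isom); apply: le_trans (metric_triangle _ _ _) (lerD (Hc _ _) _).
  by rewrite (act_dist isom); exact: fD.
have uVo i : d (pi (act (u i)^-1%g o)) o <= B + D.
  rewrite /u invgM -expgzN (actM isom).
  have nEV : ~ commensurates g (f i)^-1%g by move=> /commensuratesV; rewrite invgK; exact: nE.
  have := HB _ nEV (- n i) 0; rewrite (act_orbit0 isom) => h1.
  exact: le_trans (metric_triangle _ _ _) (lerD h1 (fVD i)).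
have back i x : c0 < d (pi (act (h (i + 1))^-1%g x)) o ->
    d (pi (act (h i)^-1%g x)) (pt (n i)) <= c2.
  have [|] := HB1 (u i)^-1%g (nEu i) (act (h (i + 1))^-1%g x).
    have := uVo i; set y := pi _; set z := pi _ => yo zy.
    by rewrite /c0; triangle z y o; lra.
  rewrite invgK -(actM isom) hS -/(u i) invgM mulVKg.
  have := uo i; set y := pi _; set z := pi _ => yo zy _.
  by rewrite /c2; triangle z y (pt (n i)); lra.
have forth i : d (pi (act (h i)^-1%g (act (h (i + 1)) o))) (pt (n i)) <= c2.
  by rewrite -(actM isom) hS -/(u i) mulKg; apply: le_trans (uo i) _; rewrite /c2; lra.
pose T := c0 + c2 + c3 + c0 + C + cw + 1.
have Cc0 : C <= c0 by rewrite /c0; lra.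
have T_step : c0 + c2 + c3 + c0 < T by rewrite /T; lra.
have TC : c0 + c2 + C <= T by rewrite /T; lra.
have Tw : c0 + c2 + cw <= T by rewrite /T; lra.
have [C' P] := bead_axis mu1 PSmu isom PSact A k0 hW back forth long Hc3 Hw c3_ge0
  Cc0 T_step TC Tw.
by exists (act (h 0) o), C'; eexists; exact: P.
Qed.

(** The conjugator [a] allows the factors of a word to be permuted cyclically. *)
Lemma single_axis D : exists T, forall a n f, ~ commensurates g f ->
  rho f <= D -> rho f^-1%g <= D -> T <= d o (pt n) ->
  exists o' C' iota', is_axis act PS (a * (expgz g n * f) * a^-1)%g o' C' iota'.
Proof.
have [T HT] := chain_axis D; exists T => a n f nE fD fVD long.
pose W := (expgz g n * f)%g.
apply: (HT _ 1%N (fun i => a * expgz W i)%g (fun=> n) (fun=> f)) => // i.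
  by rewrite addrC expgzD expgz1 !mulgA mulgVK.
by rewrite expgzD expgz1 mulgA.
Qed.

Lemma double_axis D : exists T, forall n m f f', ~ commensurates g f -> ~ commensurates g f' ->
  rho f <= D -> rho f^-1%g <= D -> rho f' <= D -> rho f'^-1%g <= D ->
  T <= d o (pt n) -> T <= d o (pt m) ->
  exists o' C' iota', is_axis act PS (expgz g n * f * (expgz g m * f'))%g o' C' iota'.
Proof.
have [T HT] := chain_axis D; exists T => n m f f' nE nE' fD fVD fD' fVD' long long'.
pose W := (expgz g n * f * (expgz g m * f'))%g; pose ev i := (i %% 2)%Z == 0.
have evS i : ev (i + 1) = ~~ ev i by rewrite /ev; lia.
have halfS i : ((i + 1) %/ 2)%Z = if ev i then (i %/ 2)%Z else (i %/ 2)%Z + 1.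
  by rewrite /ev; case: eqP => ?; lia.
have ev2 (i : int) : ev (i + 2%N) = ev i by rewrite /ev; lia.
have half2 (i : int) : ((i + 2%N) %/ 2)%Z = (i %/ 2)%Z + 1 by lia.
apply: (HT _ 2%N (fun i => expgz W (i %/ 2)%Z * (if ev i then 1 else expgz g n * f))%g
  (fun i => if ev i then n else m) (fun i => if ev i then f else f')) => // i;
  last by case: (ev i).
- by rewrite ev2 half2 addrC expgzD expgz1 mulgA.
- by rewrite evS halfS; case: (ev i); rewrite /= ?gsimp // expgzD expgz1 /W !mulgA.
all: by case: (ev i).
Qed.

End Displacement.

(** * Contracting elements and axes *)

Lemma dist_to_set_le (R : realType) (X : metricType R) (S : set X) p y :
  S y -> dist_to_set S p <= mdist y p.
Proof.
by move=> Sy; apply: ge_inf; [exists 0 => _ [z _ <-]; exact: mdist_ge0|exists y].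
Qed.

(** The infimum need not be attained, hence the 1; nonemptiness excludes the default value of
    [inf]. *)
Lemma dist_to_set_attained (R : realType) (X : metricType R) (S : set X) p (c : R) :
  S !=set0 -> dist_to_set S p <= c -> exists2 y, S y & mdist y p <= c + 1.
Proof.
move=> [z Sz] le_c.
have hi : has_inf [set mdist y p | y in S].
  by split; [exists (mdist z p), z|exists 0 => _ [w _ <-]; exact: mdist_ge0].
have [_ [y Sy <-] yc] := inf_adherent ltr01 hi; exists y => //.
by apply: le_trans (ltW yc) _; rewrite lerD2r.
Qed.

Section Conversions.
Variables (R : realType) (G : groupType) (X : metricType R) (act : G -> X -> X).
Variables (PS : path_family X) (mu : R).
Hypotheses (mu1 : 1 <= mu) (PSmu : path_system_with mu PS).
Hypotheses (isom : isometric_action act) (PSact : preserves_paths act PS).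
Local Notation d := mdist.
Implicit Types (g : G) (o x : X).

Lemma invariant_orbit g o (A : set X) : A o -> act g @` A = A ->
  cyclic_orbit act g o `<=` A.
Proof.
move=> Ao gA _ [n _ <-]; elim: n => [|n IH|n IH]; first by rewrite (act_orbit0 isom).
  by rewrite -gA -addn1 PoszD addrC expgzD (actM isom); exists (act (expgz g n) o).
move: IH; rewrite -{1}gA => -[y Ay] /(congr1 (act g^-1%g)).
rewrite (actK isom) -(actM isom) => e.
rewrite (_ : - n.+1%:Z = - 1 + - n%:Z); last by clear; lia.
by rewrite expgzD (expgzN g 1) expgz1 -e.
Qed.

(** Coboundedness puts each point of [A] within [r] of the orbit of [o], and a choice of such orbit
    points turns the projection to [A] into one to the orbit. In the constant, [2 * r] pays for
    moving two projections and 1 for the infimum in the distance to a path. *)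
Lemma orbit_projection g o (A : set X) : cyclic_orbit act g o `<=` A ->
  contracting_set PS A -> cobounded_on act g A ->
  exists C iota, projection PS C (cyclic_orbit act g o) (axis_proj act g o iota).
Proof.
move=> oA [C0 [piA [piA_A piA_id piA_contr]]] [B [BA [r Br] cob]].
have Ao : A o by apply: oA; exists 0 => //; exact: act1.
have [k [y0 By0 oE]] := cob o Ao.
have near x : exists n, d (piA x) (act (expgz g n) o) <= r.
  have [m [y By ->]] := cob _ (piA_A x); exists (m - k).
  by rewrite {1}oE (act_orbit isom) subrK (act_dist isom); exact: Br.
have [iota iotaP] := choice near.
have r0 : 0 <= r := le_trans (mdist_ge0 _ _) (Br _ _ By0 By0).
have C00 : 0 <= C0 := le_trans (mdist_ge0 _ _) (piA_id _ Ao).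
exists (C0 + 2 * r + 1), iota; split=> [|x|x ox|a b q PSq far]; first by lra.
- by exists (iota x).
- have := iotaP x; have := piA_id _ (oA _ ox); rewrite /axis_proj.
  by triangle (act (expgz g (iota x)) o) (piA x) x; lra.
have ab := special_le PSmu PSq.
have [|na nb] := piA_contr (q a) (q b) _ a b q PSq erefl erefl.
  have := iotaP (q a); have := iotaP (q b); move: far; rewrite /axis_proj.
  set pa := act _ o; set pb := act _ o.
  by triangle pa (piA (q a)) pb; triangle (piA (q a)) (piA (q b)) pb; lra.
have attain z : dist_to_set (path_image a b q) (piA z) <= C0 ->
    exists2 t, a <= t <= b & d (q t) (axis_proj act g o iota z) <= C0 + 2 * r + 1.
  move=> /dist_to_set_attained[|_ [t tab <-] tz].
    by exists (q a), a => //=; rewrite in_itv /= lexx.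
  exists t; first by move: tab; rewrite /= in_itv.
  have := iotaP z; rewrite /axis_proj => h.
  by triangle (q t) (piA z) (act (expgz g (iota z)) o); lra.
by split; exact: attain.
Qed.

Lemma contracting_axis g : proper_action act -> contracting act PS g ->
  exists o C iota, is_axis act PS g o C iota.
Proof.
move=> prop [_ [x [qi [A [Ao gA cA coA]]]]].
have [C [iota P]] := orbit_projection (invariant_orbit Ao gA) cA coA.
(* Properness bounds the set by its first condition alone, so any exponent will do. *)
exists x, C, iota; split=> // r; exists 0%N.
by apply: (sub_finite_set _ (prop x r)) => h /= [].
Qed.

Lemma weakly_contracting_axis g : weakly_contracting act PS g ->
  exists o C iota, is_axis act PS g o C iota.
Proof.
move=> [_ [qi wpd] [x [A [oA gA cA coA]]]].
have [C [iota P]] := orbit_projection oA cA coA.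
exists x, C, iota; split=> //; first by have [] := qi x.
move=> r; have [N finN] := wpd `|r| x (normr_ge0 r); exists N.
by apply: (sub_finite_set _ finN) => h /= [h1 h2]; split; apply: le_trans (ler_norm r).
Qed.

Lemma quasi_geodesic_orbit_basepoint g o x :
  quasi_geodesic_orbit act g o -> quasi_geodesic_orbit act g x.
Proof.
move=> [K [L [K1 L0 KL]]]; exists K, (L + 2 * d o x); split=> // [|m n].
  by rewrite addr_ge0 // mulr_ge0 // mdist_ge0.
have := KL m n; have close j := act_dist isom (expgz g j) o x.
have := close m; have := close n.
triangle (act (expgz g m) o) (act (expgz g m) x) (act (expgz g n) o).
triangle (act (expgz g m) x) (act (expgz g n) x) (act (expgz g n) o).
triangle (act (expgz g m) x) (act (expgz g n) o) (act (expgz g n) x).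
by move=> ? ? /andP[? ?]; apply/andP; split; lra.
Qed.

Section OfAxis.
Variables (g : G) (o : X) (C : R) (iota : X -> int).
Hypothesis A : is_axis act PS g o C iota.

Lemma axis_orbit_contracting : [/\ act g @` cyclic_orbit act g o = cyclic_orbit act g o,
  contracting_set PS (cyclic_orbit act g o) & cobounded_on act g (cyclic_orbit act g o)].
Proof.
split; first by have := orbit_act_image isom g o 1; rewrite expgz1.
  case: (axis_projection A) => C0 S id contr.
  exists C, (axis_proj act g o iota); split=> // x y far a b q PSq qa qb.
  rewrite -qa -qb in far *; have [[s sab hs] [t tab ht]] := contr _ _ _ PSq far.
  by split; [apply: le_trans hs|apply: le_trans ht]; apply: dist_to_set_le;
    [exists s|exists t] => //=; rewrite in_itv.
exists [set o]; split=> [_ ->||_ [n _ <-]].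
- by exists 0 => //; exact: act1.
- by exists 0 => _ _ -> ->; rewrite mdistxx.
by exists n, o.
Qed.

Lemma contracting_of_axis : contracting act PS g.
Proof.
split; first exact: axis_infinite_order A.
have [? ? ?] := axis_orbit_contracting.
exists o; split; first exact: axis_qi A.
by exists (cyclic_orbit act g o); split=> //; exists 0 => //; exact: act1.
Qed.

Lemma axis_orbit_morse x : morse (cyclic_orbit act g x).
Proof.
move=> K L K1 L0; have [c c0 Hc] := axis_near mu1 PSmu A (d x o).
have [D D0 HD] := proj_morse mu1 PSmu (axis_projection A) c K1 L0.
exists (D + d o x) => a b q ab qg [m _ qa] [n _ qb] t tab.
have near j y : act (expgz g j) x = y -> d y (axis_proj act g o iota y) <= c.
  by move=> <-; apply: (Hc _ j); rewrite (act_dist isom).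
apply: le_trans (dist_to_set_le _ (y := act (expgz g (iota (q t))) x) _) _.
  by exists (iota (q t)).
rewrite metric_sym; apply: le_trans (metric_triangle _ (axis_proj act g o iota (q t)) _) _.
apply: lerD; last by rewrite (act_dist isom).
by apply: HD qg (near _ _ qa) (near _ _ qb) _ _; move: tab; rewrite in_itv.
Qed.

Lemma weakly_contracting_of_axis : weakly_contracting act PS g.
Proof.
split; first exact: axis_infinite_order A.
- split=> [x|r x r0].
    by split; [exact: quasi_geodesic_orbit_basepoint (axis_qi A)|exact: axis_orbit_morse].
  have [N finN] := axis_wpd A (r + 2 * d o x); exists N.
  apply: (sub_finite_set _ finN) => h /= [h1 h2]; split.
    have := act_dist isom h x o; have := metric_sym x o.
    triangle o x (act h o); triangle x (act h x) (act h o); lra.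
  rewrite !(actM isom) in h2 *; move: h2; set k := (g ^+ N)%g.
  have := act_dist isom k x o; have := metric_sym x o.
  have := act_dist isom h (act k x) (act k o).
  triangle (act h (act k o)) (act h (act k x)) (act k o).
  triangle (act h (act k x)) (act k x) (act k o); lra.
have [? ? ?] := axis_orbit_contracting.
by exists o, (cyclic_orbit act g o); split.
Qed.

End OfAxis.
End Conversions.

(** * A common contracting element for two actions *)

Lemma avoid_rare_predicates k (P : nat -> nat -> Prop) (s : seq nat) :
  (forall l, (l < k)%N -> forall i j, P l i -> P l j -> i = j) ->
  uniq s -> (k < size s)%N -> exists2 x, x \in s & forall l, (l < k)%N -> ~ P l x.
Proof.
elim: k s => [|k IH] s rare us ks.
  by case: s us ks => // x s _ _; exists x; rewrite ?mem_head.
have rare' l : (l < k)%N -> forall i j, P l i -> P l j -> i = j.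
  by move=> lk; apply: rare; exact: leqW.
have [[x [xs Pkx]]|no] := pselect (exists x, x \in s /\ P k x); last first.
  have [x xs Px] := IH s rare' us (ltnW ks).
  exists x => // l; rewrite ltnS leq_eqVlt => /orP[/eqP-> Pkx|/Px//].
  by apply: no; exists x.
have [||y] := IH (rem x s) rare'; first by rewrite rem_uniq.
  by rewrite size_rem // -ltnS prednK // (leq_ltn_trans _ ks).
rewrite mem_rem_uniq // inE => /andP[yx ys] Py; exists y => // l.
rewrite ltnS leq_eqVlt => /orP[/eqP-> Pky|/Py//].
by case/eqP: yx; apply: rare Pky Pkx.
Qed.

Section Escape.
Variables (R : realType) (G : groupType) (X : metricType R) (act : G -> X -> X).
Variables (PS : path_family X) (mu : R).
Hypotheses (mu1 : 1 <= mu) (PSmu : path_system_with mu PS).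
Hypotheses (isom : isometric_action act) (PSact : preserves_paths act PS).
Variables (g : G) (o : X) (C : R) (iota : X -> int).
Hypothesis A : is_axis act PS g o C iota.
Local Notation rho := (proj_shift act g o iota).

Lemma orbit_unbounded (T : R) : exists n, T <= mdist o (act (expgz g n) o).
Proof.
have [N N0 HN] := orbit_far (axis_qi A) T; exists (N + 1).
rewrite leNgt; apply/negP => /ltW; rewrite -{1}(act_orbit0 isom g o) => /HN.
rewrite sub0r normrN; move: N0; clear; lia.
Qed.

(** If finitely many cosets of the commensurator covered [G], then so would finitely many cosets of
    the cyclic group of [g], because the commensurator is a finite union of these. *)
Lemma commensurator_escape : ~ virtually_cyclic G ->
  forall s : seq G, exists x, forall y, y \in s -> ~ commensurates g (y^-1 * x)%g.
Proof.
move=> nvc s; apply: contra_notP nvc => noesc; exists g.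
have [F finF HF] := axis_commensurator_cosets mu1 PSmu isom PSact A.
pose coset x := [set (x * expgz g n)%g | n in [set: int]].
apply: (sub_finite_set (B := \bigcup_(y in [set` s]) [set coset (y * f)%g | f in F])).
  move=> _ [x _ <-].
  have [y [ys Ey]] : exists y, y \in s /\ commensurates g (y^-1 * x)%g.
    apply: contra_notP noesc => no; exists x => y ys Ey.
    by apply: no; exists y.
  have [n Fn] := HF _ Ey; exists y => //; exists (y^-1 * x * expgz g n)%g => //.
  rewrite /coset; apply/seteqP; split=> [_ [m _ <-]|_ [m _ <-]].
    by exists (n + m) => //; rewrite expgzD !gnorm.
  by exists (m - n) => //; rewrite addrC expgzD expgzN !gnorm.
by apply: bigcup_finite => [|y _]; [exact: finite_seq|exact: finite_image].
Qed.

Lemma commensurator_power x : infinite_order x -> commensurates g x ->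
  exists j l : int, [/\ j != 0, l != 0 & expgz x j = expgz g l].
Proof.
move=> x_inf Ex.
have [F finF HF] := axis_commensurator_cosets mu1 PSmu isom PSact A.
have Exn (i : nat) : commensurates g (expgz x i).
  elim: i => [|i IH]; first exact: (commensurates_expgz g 0).
  by rewrite -addn1 PoszD expgzS; exact: commensuratesM.
have [e He] := choice (fun i : nat => HF _ (Exn i)).
have [n Hn] := finite_set_pigeonhole finF.
have [i [j [ij _ eij]]] := Hn _ (fun i _ => He i).
exists (j%:Z - i%:Z), (e i - e j).
have E : expgz x (j%:Z - i%:Z) = expgz g (e i - e j).
  apply: (@mulgI _ (expgz x i)); rewrite -expgzD addrC subrK expgzD mulgA eij.
  by rewrite expgzN mulgK.
have ji : j%:Z - i%:Z != 0 by apply/eqP; lia.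
split=> //; apply: contra_neq ji => e0.
by apply: (expgz_eq1 x_inf); rewrite E e0.
Qed.

(** [D] is independent of [u]: the Behrstock inequality for [v^(i - i')] at [v^i u] bounds the shift
    of [v^i u] or of [v^i' u], and a right factor from a finite set changes it boundedly. *)
Lemma proj_shift_powers v (M : int) : (forall k, k != 0 -> ~ commensurates g (expgz v k)) ->
  exists D, forall u i i', `|i| <= M -> `|i'| <= M -> i != i' ->
    (forall j, `|j| <= M -> rho (expgz v i * u * expgz v j)%g <= D) \/
    (forall j, `|j| <= M -> rho (expgz v i' * u * expgz v j)%g <= D).
Proof.
move=> vE; have [B B0 HB] := proj_shift_alternative mu1 PSmu isom PSact A.
have [K K0 HK] := finite_set_bounded (fun m => rho (expgz v m)) (finite_int_ball (M + M)).
have [c Hc] := choice (fun j : int =>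
  let: ex_intro2 c _ H := proj_shiftMr mu1 PSmu isom A (expgz v j) in
  ex_intro (fun c => forall u, rho (u * expgz v j)%g <= c + rho u) c H).
have [c' c'0 Hc'] := finite_set_bounded c (finite_int_ball M).
exists (c' + (B + K)) => u i i' iM i'M ii'.
have bound k : rho (expgz v k * u)%g <= B + K ->
    forall j, `|j| <= M -> rho (expgz v k * u * expgz v j)%g <= c' + (B + K).
  by move=> h j jM; apply: le_trans (Hc j _) _; apply: lerD => //; exact: Hc'.
have [|h|h] := HB (expgz v (i - i')) (expgz v i * u)%g.
- by apply: vE; rewrite subr_eq0.
- by left; apply: bound; apply: le_trans h _; rewrite lerD2l; apply: HK => /=; lia.
right; apply: bound; move: h; rewrite -expgzN opprB mulgA -expgzD subrK => h.
by apply: le_trans h _; rewrite lerD2l; apply: HK => /=; lia.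
Qed.

End Escape.

Section TwoActions.
Variables (R : realType) (G : groupType) (X1 X2 : metricType R).
Variables (act1 : G -> X1 -> X1) (act2 : G -> X2 -> X2).
Variables (PS1 : path_family X1) (PS2 : path_family X2) (mu mu' : R).
Hypotheses (mu1 : 1 <= mu) (PSmu : path_system_with mu PS1).
Hypotheses (isom1 : isometric_action act1) (PSact1 : preserves_paths act1 PS1).
Hypotheses (mu1' : 1 <= mu') (PSmu' : path_system_with mu' PS2).
Hypotheses (isom2 : isometric_action act2) (PSact2 : preserves_paths act2 PS2).
Variables (g1 g2 : G) (o1 : X1) (o2 : X2) (C1 C2 : R) (iota1 : X1 -> int) (iota2 : X2 -> int).
Hypotheses (A1 : is_axis act1 PS1 g1 o1 C1 iota1) (A2 : is_axis act2 PS2 g2 o2 C2 iota2).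

(* v = a g1 a^-1 with a outside the commensurator of g1. Those a for which some
   nonzero power of v commensurates g2 lie in one coset of that commensurator. *)
Lemma common_escaping_element : ~ virtually_cyclic G -> exists v, forall k, k != 0 ->
  ~ commensurates g1 (expgz v k) /\ ~ commensurates g2 (expgz v k).
Proof.
move=> nvc; have g1_inf := axis_infinite_order A1.
have escape := commensurator_escape mu1 PSmu isom1 PSact1 A1 nvc.
pose linked a := exists k l : int, [/\ k != 0, l != 0 &
  (a * expgz g1 k)%g = (expgz g2 l * a)%g].
have one_coset a b : linked a -> linked b -> commensurates g1 (b^-1 * a)%g.
  move=> [k [l [k0 l0 kl]]] [k' [l' [k'0 l'0 kl']]].
  exists (k * l'), (k' * l); split; rewrite ?mulf_neq0 //.
  apply: (@mulgI _ b); rewrite !mulgA mulgV mul1g.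
  rewrite expgzM (expgz_intertwine l' kl) -(expgzM g2) mulrC (expgzM g2).
  by rewrite expgzM (expgz_intertwine l kl') mulgK.
have [a [na nla]] : exists a, ~ commensurates g1 a /\ ~ linked a.
  have [a Ha] := escape [:: 1%g]; have [b Hb] := escape [:: 1%g; a].
  have na : ~ commensurates g1 a by have := Ha 1%g (mem_head _ _); rewrite invg1 mul1g.
  have nb : ~ commensurates g1 b by have := Hb 1%g (mem_head _ _); rewrite invg1 mul1g.
  have [la|] := pselect (linked a); last by exists a.
  exists b; split=> // lb; have := Hb a; rewrite !inE eqxx orbT => /(_ isT).
  by apply; exact: one_coset lb la.
exists (a * g1 * a^-1)%g => k k0; rewrite expgz_conj.
have pow j : expgz (a * expgz g1 k * a^-1)%g j = (a * expgz g1 (k * j) * a^-1)%g.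
  by rewrite expgz_conj -expgzM.
have x_inf : infinite_order (a * expgz g1 k * a^-1)%g.
  move=> j j0; rewrite -expgz_nat pow => e; have : k * j%:Z = 0.
    apply: (expgz_eq1 g1_inf); apply: (@mulgI _ a); apply: (@mulIg _ a^-1%g).
    by rewrite e mulg1 mulgV.
  by move/eqP; rewrite mulf_eq0 (negbTE k0) /= eqz_nat; case: (j) j0.
have turn j g l : expgz (a * expgz g1 k * a^-1)%g j = expgz g l ->
    (a * expgz g1 (k * j))%g = (expgz g l * a)%g by move=> <-; rewrite pow mulgVK.
split=> Ek.
  have [j [l [j0 l0 e]]] := commensurator_power mu1 PSmu isom1 PSact1 A1 x_inf Ek.
  by apply: na; exists (k * j), l; split; [rewrite mulf_neq0| |exact: turn].
have [j [l [j0 l0 e]]] := commensurator_power mu1' PSmu' isom2 PSact2 A2 x_inf Ek.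
by apply: nla; exists (k * j), l; split; [rewrite mulf_neq0| |exact: turn].
Qed.

(* W = g1^n v^i g2^m v^j. The bounds D1, D2 do not depend on n and m, so large n and
   m can be fixed first; then all but few small i, j satisfy the conditions of
   single_axis for W in X1 and, after cyclic permutation of its factors, in X2. *)
Lemma common_axis : ~ virtually_cyclic G -> exists W,
  (exists o C iota, is_axis act1 PS1 W o C iota) /\
  (exists o C iota, is_axis act2 PS2 W o C iota).
Proof.
move=> /common_escaping_element[v vE].
have v1 k (k0 : k != 0) : ~ commensurates g1 (expgz v k) by case: (vE k k0).
have v2 k (k0 : k != 0) : ~ commensurates g2 (expgz v k) by case: (vE k k0).
have [D1 HD1] := proj_shift_powers mu1 PSmu isom1 PSact1 A1 4 v1.
have [D2 HD2] := proj_shift_powers mu1' PSmu' isom2 PSact2 A2 4 v2.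
have [T1 HT1] := single_axis mu1 PSmu isom1 PSact1 A1 D1.
have [T2 HT2] := single_axis mu1' PSmu' isom2 PSact2 A2 D2.
have [n Hn] := orbit_unbounded isom1 A1 T1; have [m Hm] := orbit_unbounded isom2 A2 T2.
pose u1 := expgz g1 n; pose u2 := expgz g2 m.
pose good1 u i := forall j, `|j| <= 4 ->
  proj_shift act1 g1 o1 iota1 (expgz v i * u * expgz v j)%g <= D1.
pose good2 u i := forall j, `|j| <= 4 ->
  proj_shift act2 g2 o2 iota2 (expgz v i * u * expgz v j)%g <= D2.
have rare1 u (i j : int) : `|i| <= 4 -> `|j| <= 4 -> ~ good1 u i -> ~ good1 u j -> i = j.
  by move=> i4 j4 ni nj; apply: contrapT => /eqP ij; case: (HD1 u i j i4 j4 ij).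
have rare2 u (i j : int) : `|i| <= 4 -> `|j| <= 4 -> ~ good2 u i -> ~ good2 u j -> i = j.
  by move=> i4 j4 ni nj; apply: contrapT => /eqP ij; case: (HD2 u i j i4 j4 ij).
have rare_E g u (i j : int) : (forall k, k != 0 -> ~ commensurates g (expgz v k)) ->
    commensurates g (u * expgz v i)%g -> commensurates g (u * expgz v j)%g -> i = j.
  move=> vg /commensuratesV Ei Ej; apply: contrapT => /eqP ij.
  apply: (vg (j - i)); first by rewrite subr_eq0 eq_sym.
  by have := commensuratesM Ei Ej; rewrite invgM !gnorm -expgzN -expgzD addrC.
have rare_E' g u (i j : int) : (forall k, k != 0 -> ~ commensurates g (expgz v k)) ->
    commensurates g (expgz v i * u)%g -> commensurates g (expgz v j * u)%g -> i = j.
  move=> vg Ei /commensuratesV Ej; apply: contrapT => /eqP ij.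
  apply: (vg (i - j)); first by rewrite subr_eq0.
  by have := commensuratesM Ei Ej; rewrite invgM !gnorm -expgzN -expgzD.
have small (i : nat) : (i <= 4)%N -> `|i%:Z| <= 4 /\ `|- i%:Z| <= 4.
  by rewrite normrN.
(* The letter between powers of [g1] is [v^i u2 v^j], and between powers of [g2] it is [v^j u1 v^i].
   The conditions on the first letter and on the inverse of the second involve [i] on the left, so
   three candidates for [i] suffice. *)
pose P l (i : nat) := (i <= 4)%N /\ match l with
  | 0 => ~ good1 u2 i
  | _ => ~ good2 u1^-1%g (- i%:Z) end.
have [[|[|l]] _ i1 i2 [/small[+ +] hi1] [/small[+ +] hi2]|i iI Pi] :=
    @avoid_rare_predicates 2 P (iota 0 3) _ (iota_uniq _ _) isT.
- by move=> a1 _ a2 _; have /eqP := rare1 _ _ _ a1 a2 hi1 hi2; rewrite eqz_nat => /eqP.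
- by move=> _ a1 _ a2; have /oppr_inj[] := rare2 _ _ _ a1 a2 hi1 hi2.
- by move=> _ a1 _ a2; have /oppr_inj[] := rare2 _ _ _ a1 a2 hi1 hi2.
have i4 : (i <= 4)%N by move: iI; rewrite mem_iota => /andP[_ /ltnW/leq_trans]; apply.
have gi1 : good1 u2 i by apply: contrapT => ng; exact: (Pi 0%N).
have gi2 : good2 u1^-1%g (- i%:Z) by apply: contrapT => ng; exact: (Pi 1%N).
(* The two remaining shift bounds, and both letters being outside the commensurators; each fails for
   at most one [j], so five candidates suffice. *)
pose Q l (j : nat) := (j <= 4)%N /\ match l with
  | 0 => ~ good1 u2^-1%g (- j%:Z)
  | 1 => ~ good2 u1 j
  | 2 => commensurates g1 (expgz v i * u2 * expgz v j)%g
  | _ => commensurates g2 (expgz v j * (u1 * expgz v i))%g end.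
have [[|[|[|l]]] _ j1 j2 [/small[+ +] hj1] [/small[+ +] hj2]|j jI Qj] :=
    @avoid_rare_predicates 4 Q (iota 0 5) _ (iota_uniq _ _) isT.
- by move=> _ a1 _ a2; have /oppr_inj[] := rare1 _ _ _ a1 a2 hj1 hj2.
- by move=> a1 _ a2 _; have [] := rare2 _ _ _ a1 a2 hj1 hj2.
- by move=> _ _ _ _; have [] := rare_E _ _ _ _ v1 hj1 hj2.
- by move=> _ _ _ _; have [] := rare_E' _ _ _ _ v2 hj1 hj2.
have j4 : (j <= 4)%N by move: jI; rewrite mem_iota.
have gj1 : good1 u2^-1%g (- j%:Z) by apply: contrapT => ng; exact: (Qj 0%N).
have gj2 : good2 u1 j by apply: contrapT => ng; exact: (Qj 1%N).
have nE1 : ~ commensurates g1 (expgz v i * u2 * expgz v j)%g by move=> ?; exact: (Qj 2%N).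
have nE2 : ~ commensurates g2 (expgz v j * u1 * expgz v i)%g.
  by rewrite -mulgA => ?; exact: (Qj 3%N).
have [iP iN] := small i i4; have [jP jN] := small j j4.
exists (u1 * (expgz v i * u2 * expgz v j))%g; split.
  have := HT1 1%g n _ nE1 (gi1 _ jP) _ Hn; rewrite invg1 mulg1 mul1g; apply.
  by have := gj1 _ iN; rewrite !expgzN !invgM mulgA.
(* Conjugation by [u1 v^i] turns [u2 (v^j u1 v^i)] into [W]. *)
have := HT2 (u1 * expgz v i)%g m _ nE2 (gj2 _ iP) _ Hm.
rewrite -/u2 (_ : (_ * _ * _^-1 = u1 * (expgz v i * u2 * expgz v j))%g); last first.
  by rewrite !mulgA; rewrite !gnorm.
by apply; have := gi2 _ jN; rewrite !expgzN !invgM mulgA.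
Qed.

End TwoActions.

(** * Amenable quotients *)

Section Mean.
Variables (R : realType) (H : groupType) (m : set H -> R).
Hypotheses (m_ge0 : forall A, 0 <= m A) (mT : m setT = 1).
Hypothesis mU : forall A B, A `&` B = set0 -> m (A `|` B) = m A + m B.
Hypothesis mI : forall h A, m [set (h * a)%g | a in A] = m A.

Lemma mean_le A B : A `<=` B -> m A <= m B.
Proof.
by move=> AB; rewrite -(setDUK AB) mU ?setDIK // lerDl.
Qed.

Lemma mean_union A B : m (A `|` B) <= m A + m B.
Proof.
have -> : A `|` B = A `|` (B `\` A).
  by apply/seteqP; split=> x; have [] := pselect (A x); firstorder.
by rewrite mU ?setDIK // lerD2l; apply: mean_le => x [].
Qed.

Lemma mean_translates (s : nat -> H) (B : set H) n :
  (forall i j, (i < j)%N -> (j < n)%N -> forall b b', B b -> B b' -> (s i * b <> s j * b')%g) ->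
  n%:R * m B <= 1.
Proof.
move=> dis; pose U k := [set y | exists i, (i < k)%N /\ exists2 b, B b & (s i * b)%g = y].
suff : forall k, (k <= n)%N -> m (U k) = k%:R * m B.
  by move=> /(_ n (leqnn n)) <-; rewrite -mT; exact: mean_le.
elim=> [|k IH] kn.
  rewrite mul0r; have -> : U 0%N = set0 by apply/seteqP; split=> y // [? []].
  by have := mU (setI0 set0); rewrite setU0; lra.
have -> : U k.+1 = U k `|` [set (s k * b)%g | b in B].
  apply/seteqP; split=> [y [i [+ yi]]|y [[i [ik yi]]|yk]].
  - by rewrite ltnS leq_eqVlt => /orP[/eqP <-|ik]; [right|left; exists i].
  - by exists i; split=> //; exact: leqW.
  - by exists k.
rewrite mU ?mI ?IH ?(ltnW kn) // -?natr1 ?mulrDl ?mul1r //.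
apply/seteqP; split=> // y [[i [ik [b Bb <-]]] [b' Bb' e]].
by apply: (dis i k ik kn b b') => //; exact: esym.
Qed.

End Mean.

Section AmenableQuotient.
Variables (R : realType) (G H : groupType) (phi : {multiplicative G -> H}).

(** The mean lives on [H], not on the image of [phi]. Representatives of the cosets [phi(G) y]
    spread a subset of the image over all of [H]. *)
Definition coset_rep (y : H) : H := xget 1%g [set z | exists x, z = (phi x * y)%g].

Lemma coset_rep_translate x y : coset_rep (phi x * y)%g = coset_rep y.
Proof.
rewrite /coset_rep; congr (xget _ _); apply/seteqP; split=> z [w ->].
  by exists (w * x)%g; rewrite gmulfM mulgA.
by exists (w * x^-1)%g; rewrite gmulfM multiplicativeV mulgA mulgVK.
Qed.

Lemma coset_repP y : exists x, y = (phi x * coset_rep y)%g.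
Proof.
have [|x e] := @xgetPex _ 1%g [set z | exists x, z = (phi x * y)%g].
  by exists (phi 1%g * y)%g, 1%g.
by exists x^-1%g; rewrite /coset_rep e multiplicativeV mulKg.
Qed.

(* Write y = phi x * t with t the chosen representative of the coset phi(G) y:
   then y is in the pullback of A if and only if phi x is in phi(A). *)
Definition pullback_set (A : set G) : set H :=
  [set y | exists2 a, A a & y = (phi a * coset_rep y)%g].

Lemma pullback_set_small (m : set H -> R) (s : nat -> G) (A : set G) n :
  (forall A, 0 <= m A) -> m setT = 1 ->
  (forall A B, A `&` B = set0 -> m (A `|` B) = m A + m B) ->
  (forall h A, m [set (h * a)%g | a in A] = m A) ->
  (forall i j, (i < j)%N -> (j < n)%N -> forall a a', A a -> A a' ->
    phi (s i * a)%g <> phi (s j * a')%g) ->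
  n%:R * m (pullback_set A) <= 1.
Proof.
move=> m0 mT mU mI dis; apply: (mean_translates m0 mT mU mI (s := phi \o s)).
move=> i j ij jn b b' [a Aa ->] [a' Aa' ->] /= e.
have r : coset_rep b = coset_rep b'.
  have idem y : coset_rep (coset_rep y) = coset_rep y.
    by have [x yx] := coset_repP y; rewrite {2}yx coset_rep_translate.
  by have := congr1 (coset_rep) e; rewrite !coset_rep_translate !idem.
apply: (dis i j ij jn a a' Aa Aa'); rewrite !gmulfM.
by apply: (@mulIg _ (coset_rep b)); rewrite -!mulgA {2}r.
Qed.

End AmenableQuotient.

Section AmenableKernel.
Variables (R : realType) (G : groupType) (X : metricType R) (act : G -> X -> X).
Variables (PS : path_family X) (mu : R).
Hypotheses (mu1 : 1 <= mu) (PSmu : path_system_with mu PS).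
Hypotheses (isom : isometric_action act) (PSact : preserves_paths act PS).
Variables (g : G) (o : X) (C : R) (iota : X -> int).
Hypothesis A : is_axis act PS g o C iota.
Hypothesis nvc : ~ virtually_cyclic G.
Local Notation rho := (proj_shift act g o iota).

Lemma escaping_sequence n : exists s : seq G, size s = n /\
  forall i j, (i < j)%N -> (j < n)%N -> ~ commensurates g ((nth 1 s i)^-1 * nth 1 s j)%g.
Proof.
elim: n => [|n [s [sn sE]]]; first by exists [::].
have [x Hx] := commensurator_escape mu1 PSmu isom PSact A nvc s.
exists (rcons s x); rewrite size_rcons sn; split=> // i j ij.
rewrite ltnS leq_eqVlt !nth_rcons sn => /orP[/eqP jn|jn].
  by rewrite -{1}jn ij jn ltnn eqxx; apply: Hx; rewrite mem_nth // sn -jn.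
by rewrite jn (ltn_trans ij jn); exact: sE.
Qed.

(* Otherwise the mean of H would give mass at most 1/4 to each of the three
   parts E, {h notin E, rho h > c} and {h notin E, rho h <= c} of G, where E is
   the commensurator of g: each has four translates disjoint modulo the kernel. *)
Lemma amenable_kernel_escapes (H : groupType) (phi : {multiplicative G -> H}) :
  amenable H R -> exists u, phi u = 1%g /\ ~ commensurates g u.
Proof.
move=> [m [m0 mT mU mI]]; apply: contrapT => noesc.
have kerE u : phi u = 1%g -> commensurates g u.
  by move=> pu; apply: contrapT => nEu; apply: noesc; exists u.
have eqE x y : phi x = phi y -> commensurates g (x^-1 * y)%g.
  by move=> e; apply: kerE; rewrite gmulfM multiplicativeV e mulVg.
have [s [s4 sE]] := escaping_sequence 4.
have [B B0 HB] := proj_shift_alternative mu1 PSmu isom PSact A.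
have [c5 c50 Hc5] := proj_shift_commensurates mu1 PSmu isom PSact A.
have [c4 c40 Hc4] := proj_shift_expgzM mu1 PSmu isom PSact A.
have [K K0 HK] := finite_set_bounded rho
  (finite_seq [seq (x^-1 * y)%g | x <- s, y <- s]).
pose c := c5 + B + K.
have [N N0 HN] := orbit_far (axis_qi A) (c4 + c + (c5 + c)).
have HKs i j : (i < 4)%N -> (j < 4)%N -> rho ((nth 1 s i)^-1 * nth 1 s j)%g <= K.
  by move=> i4 j4; apply: HK; apply/allpairsP; exists (nth 1 s i, nth 1 s j)%g;
    rewrite !mem_nth ?s4.
pose E := [set x | commensurates g x].
(* In [P], the Behrstock inequality for the quotients of members of [s] separates translates:
   [B + K] bounds the shift it allows and [c5] absorbs the element of the commensurator by which
   equal images may differ. *)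
pose P := [set x | ~ commensurates g x /\ c < rho x].
pose Q := [set x | ~ commensurates g x /\ rho x <= c].
have small := pullback_set_small (phi := phi) m0 mT mU mI.
have mE : 4%:R * m (pullback_set phi E) <= 1.
  apply: (small (nth 1%g s)) => i j ij j4 a a' Ea Ea' /eqE.
  rewrite invgM -!mulgA => /(commensuratesM Ea); rewrite mulVKg mulgA => Es.
  by apply: (sE i j ij j4); have := commensuratesM Es (commensuratesV Ea'); rewrite mulgK.
have mP : 4%:R * m (pullback_set phi P) <= 1.
  apply: (small (nth 1%g s)) => i j ij j4 a a' [Ea ra] [Ea' ra'] /eqE.
  set si := nth _ _ i; set sj := nth _ _ j; set u := (_^-1 * _)%g => Eu.
  have au : ((si^-1 * sj) * a' = a * u)%g by rewrite /u invgM !mulgA mulgV mul1g.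
  have [h|h] := HB (si^-1 * sj)%g (a * u)%g (sE i j ij j4).
    have nEau : ~ commensurates g (a * u)%g.
      by move=> /commensuratesM/(_ (commensuratesV Eu)); rewrite mulgK.
    have := Hc5 _ _ nEau (commensuratesV Eu); rewrite mulgK => ha.
    by have := HKs i j (ltn_trans ij j4) j4; move: ra h ha; rewrite /c; lra.
  move: h; rewrite -au mulKg invgM invgK => h.
  by have := HKs j i j4 (ltn_trans ij j4); move: ra' h; rewrite /c; lra.
(* Shifts are bounded on [Q], so powers of [g] with exponents [N + 1] apart move it off itself, even
   up to a right factor from the commensurator. *)
have mQ : 4%:R * m (pullback_set phi Q) <= 1.
  apply: (small (fun i => expgz g ((N + 1) * i%:Z))) => i j ij j4 a a' [Ea ra] [Ea' ra'] /eqE.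
  set u := (_^-1 * _)%g => Eu.
  have au : (a * u = expgz g ((N + 1) * (j%:Z - i%:Z)) * a')%g.
    rewrite /u invgM !mulgA mulgV mul1g -expgzN -expgzD; congr (expgz _ _ * _)%g.
    by rewrite mulrBr addrC.
  have := Hc5 _ _ Ea Eu; have := Hc4 ((N + 1) * (j%:Z - i%:Z)) a'; rewrite -au => h1 h2.
  have /HN : mdist (act (expgz g 0) o) (act (expgz g ((N + 1) * (j%:Z - i%:Z))) o)
      <= c4 + c + (c5 + c) by rewrite (act_orbit0 isom); lra.
  by rewrite sub0r normrN; move: N0 ij; clear; nia.
have : m setT <= m (pullback_set phi E) + (m (pullback_set phi P) + m (pullback_set phi Q)).
  apply: le_trans (mean_le m0 mU
    (B := pullback_set phi E `|` (pullback_set phi P `|` pullback_set phi Q)) _) _.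
    move=> y _; have [x yx] := coset_repP phi y.
    have [Ex|nEx] := pselect (commensurates g x); first by left; exists x.
    by right; have [le|gt] := leP (rho x) c; [right|left]; exists x.
  apply: le_trans (mean_union m0 mU _ _) _; rewrite lerD2l; exact: mean_union.
by rewrite mT; lra.
Qed.

Lemma amenable_fiber_axis (H : groupType) (phi : {multiplicative G -> H}) k :
  amenable H R -> exists W, phi W = phi k /\ exists o' C' iota', is_axis act PS W o' C' iota'.
Proof.
move=> /amenable_kernel_escapes-/(_ phi)[u [pu nEu]].
have [k' [pk' nEk']] : exists k', phi k' = phi k /\ ~ commensurates g k'.
  have [Ek|nEk] := pselect (commensurates g k); last by exists k.
  exists (k * u)%g; split; first by rewrite gmulfM pu mulg1.
  by move=> /(commensuratesM (commensuratesV Ek)); rewrite mulKg.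
pose D := rho u + rho u^-1%g + rho k' + rho k'^-1%g.
have [T HT] := double_axis mu1 PSmu isom PSact A D.
have [n Hn] := orbit_unbounded isom A T.
exists (expgz g n * u * (expgz g (- n) * k'))%g; split.
  by rewrite !gmulfM pu pk' mulg1 expgzN multiplicativeV mulVKg.
have ge0 h : 0 <= rho h := proj_shift_ge0 act g o iota h.
have := ge0 u; have := ge0 u^-1%g; have := ge0 k'; have := ge0 k'^-1%g => ? ? ? ?.
apply: HT => //; rewrite ?/D; try lra.
by apply: le_trans Hn _; rewrite metric_sym (dist_actV isom) -expgzN.
Qed.

End AmenableKernel.

(** * Change of group along an isomorphism *)

Section Transport.
Variables (R : realType) (G1 G2 : groupType) (X : metricType R).
Variables (act : G2 -> X -> X) (PS : path_family X) (phi : {multiplicative G1 -> G2}).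
Local Notation act' := (fun h => act (phi h)).

Lemma weak_path_system_on_pullback :
  weak_path_system_on act PS -> weak_path_system_on act' PS.
Proof.
move=> [[a1 aM ad] ps pres]; split=> //; last by move=> h a b q; exact: pres.
by split=> [x|h k x|h x y]; rewrite ?multiplicative1 ?gmulfM //.
Qed.

Lemma cyclic_orbit_pullback g o : cyclic_orbit act' g o = cyclic_orbit act (phi g) o.
Proof. by apply/seteqP; split=> _ [n _ <-]; exists n; rewrite //= expgz_morph. Qed.

Lemma axis_proj_pullback g o (iota : X -> int) :
  axis_proj act' g o iota = axis_proj act (phi g) o iota.
Proof. by apply/funext => x; rewrite /axis_proj expgz_morph. Qed.

Lemma quasi_geodesic_orbit_pullback g o :
  quasi_geodesic_orbit act' g o <-> quasi_geodesic_orbit act (phi g) o.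
Proof.
by split=> -[K [L [K1 L0 KL]]]; exists K, L; split=> // m n; have := KL m n;
  rewrite !expgz_morph.
Qed.

Lemma is_axis_pullback g o C iota : bijective phi ->
  is_axis act' PS g o C iota <-> is_axis act PS (phi g) o C iota.
Proof.
move=> [psi phiK psiK]; split=> -[qi P wpd]; split.
- exact/quasi_geodesic_orbit_pullback.
- by rewrite -cyclic_orbit_pullback -axis_proj_pullback.
- move=> r; have [N finN] := wpd r; exists N.
  apply: (sub_finite_set _ (finite_image phi finN)) => h /= hr; exists (psi h) => //=.
  by rewrite -!expgz_nat gmulfM psiK !expgz_morph.
- exact/quasi_geodesic_orbit_pullback.
- by rewrite cyclic_orbit_pullback axis_proj_pullback.
move=> r; have [N finN] := wpd r; exists N.
apply: (sub_finite_set _ (finite_image psi finN)) => h /= hr; exists (phi h) => //=.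
by move: hr; rewrite -!expgz_nat gmulfM !expgz_morph.
Qed.

End Transport.

(** * Both notions of contracting element as the existence of an axis *)

Definition has_axis (R : realType) (G : groupType) (X : metricType R)
    (act : G -> X -> X) (PS : path_family X) (g : G) : Prop :=
  exists o C iota, is_axis act PS g o C iota.

Lemma weakly_contractingP (R : realType) (G : groupType) (X : metricType R)
    (act : G -> X -> X) (PS : path_family X) g : weak_path_system_on act PS ->
  weakly_contracting act PS g <-> has_axis act PS g.
Proof.
move=> [isom [mu mu1 PSmu] pres]; split; first exact: (weakly_contracting_axis PSmu isom).
by move=> [x [C [iota A]]]; exact: (weakly_contracting_of_axis mu1 PSmu isom A).
Qed.

Lemma contractingP (R : realType) (G : groupType) (X : metricType R)
    (act : G -> X -> X) (PS : path_family X) g : path_system_on act PS ->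
  contracting act PS g <-> has_axis act PS g.
Proof.
move=> [[isom [mu mu1 PSmu] pres] prop]; split; first exact: (contracting_axis PSmu isom prop).
by move=> [x [C [iota A]]]; exact: (contracting_of_axis isom A).
Qed.

Lemma has_axis_isomorphism (R : realType) (G1 G2 : groupType) (X1 X2 : metricType R)
    (act1 : G1 -> X1 -> X1) (act2 : G2 -> X2 -> X2)
    (PS1 : path_family X1) (PS2 : path_family X2) g1 g2 :
  weak_path_system_on act1 PS1 -> weak_path_system_on act2 PS2 ->
  ~ virtually_cyclic G1 -> has_axis act1 PS1 g1 -> has_axis act2 PS2 g2 ->
  forall phi : {multiplicative G1 -> G2}, bijective phi ->
    exists g, has_axis act1 PS1 g /\ has_axis act2 PS2 (phi g).
Proof.
move=> [isom1 [mu mu1 PSmu] pres1] /weak_path_system_on_pullback H2 nvc.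
move=> [x1 [C1 [iota1 A1]]] [x2 [C2 [iota2 A2]]] phi bij.
have [isom2 [mu' mu1' PSmu'] pres2] := H2 G1 phi.
have [psi phiK psiK] := bij; rewrite -(psiK g2) in A2.
have A2' := (is_axis_pullback act2 PS2 _ _ _ _ bij).2 A2.
have [W [ax1 [x [C [iota ax2]]]]] :=
  common_axis mu1 PSmu isom1 pres1 mu1' PSmu' isom2 pres2 A1 A2' nvc.
exists W; split=> //; exists x, C, iota.
exact: (is_axis_pullback act2 PS2 _ _ _ _ bij).1 ax2.
Qed.

Lemma has_axis_amenable_fiber (R : realType) (G : groupType) (X : metricType R)
    (act : G -> X -> X) (PS : path_family X) g :
  weak_path_system_on act PS -> ~ virtually_cyclic G -> has_axis act PS g ->
  forall (H : groupType) (phi : {multiplicative G -> H}), amenable H R ->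
    forall h, range phi h -> exists g', has_axis act PS g' /\ phi g' = h.
Proof.
move=> [isom [mu mu1 PSmu] pres] nvc [x [C [iota A]]] H phi amH _ [k _ <-].
have [W [Wk ax]] := amenable_fiber_axis mu1 PSmu isom pres A nvc phi k amH.
by exists W.
Qed.
Theorem corollary1p5
  (R : realType) (G1 G2 : groupType) (X1 X2 : metricType R)
  (act1 : G1 -> X1 -> X1) (act2 : G2 -> X2 -> X2)
  (PS1 : path_family X1) (PS2 : path_family X2)
  (nonelem1 : ~ virtually_cyclic G1) (nonelem2 : ~ virtually_cyclic G2) :
  (path_system_on act1 PS1 -> path_system_on act2 PS2 ->
   (exists g, contracting act1 PS1 g) -> (exists g, contracting act2 PS2 g) ->
   (forall phi : {multiplicative G1 -> G2}, bijective phi ->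
      exists g, contracting act1 PS1 g /\ contracting act2 PS2 (phi g)) /\
   (forall (H : groupType) (phi : {multiplicative G1 -> H}), amenable H R ->
      forall h, range phi h ->
        exists g, contracting act1 PS1 g /\ phi g = h))
  /\
  (weak_path_system_on act1 PS1 -> weak_path_system_on act2 PS2 ->
   (exists g, weakly_contracting act1 PS1 g) ->
   (exists g, weakly_contracting act2 PS2 g) ->
   (forall phi : {multiplicative G1 -> G2}, bijective phi ->
      exists g, weakly_contracting act1 PS1 g /\
                weakly_contracting act2 PS2 (phi g)) /\
   (forall (H : groupType) (phi : {multiplicative G1 -> H}), amenable H R ->
      forall h, range phi h ->
        exists g, weakly_contracting act1 PS1 g /\ phi g = h)).
Proof.
split=> H1 H2 [g1 g1P] [g2 g2P].
  have [W1 _] := H1; have [W2 _] := H2.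
  move: g1P g2P => /(contractingP _ H1) a1 /(contractingP _ H2) a2; split.
    move=> phi bij; have [g [h1 h2]] := has_axis_isomorphism W1 W2 nonelem1 a1 a2 bij.
    by exists g; split; [exact/(contractingP _ H1)|exact/(contractingP _ H2)].
  move=> H phi amH h hr; have [g [h1 h2]] := has_axis_amenable_fiber W1 nonelem1 a1 amH hr.
  by exists g; split=> //; exact/(contractingP _ H1).
move: g1P g2P => /(weakly_contractingP _ H1) a1 /(weakly_contractingP _ H2) a2; split.
  move=> phi bij; have [g [h1 h2]] := has_axis_isomorphism H1 H2 nonelem1 a1 a2 bij.
  by exists g; split; [exact/(weakly_contractingP _ H1)|exact/(weakly_contractingP _ H2)].
move=> H phi amH h hr; have [g [h1 h2]] := has_axis_amenable_fiber H1 nonelem1 a1 amH hr.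
by exists g; split=> //; exact/(weakly_contractingP _ H1).
Qed.
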